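(* A subcategory $\mathcal{T}$ of $\mathcal{C}_2$ is cluster tilting if and only if its indecomposable objects correspond to a triangulation of the completed $\infty$-gon containing a fountain at some $a\in\mathbb{Z}$.
   Context: Let $R=\mathbb{C}[x,y]/(x^2)$, graded with $\deg x=1$, $\deg y=-1$; $M(j)_n=M_{j+n}$. $\mathcal{C}_2$ is the Frobenius category of finitely generated $\mathbb{Z}$-graded maximal Cohen–Macaulay $R$-modules with degree-preserving morphisms. An arc of the completed $\infty$-gon is $(a,b)$ with $a\in\mathbb{Z}\cup\{-\infty\}$, $b\in\mathbb{Z}$, $a<b$; indecomposables correspond to arcs via $(x,y^k)(j)\leftrightarrow(-j-k,1-j)$ ($k\ge0$, $(x,y^0)=R$) and $\mathbb{C}[y](j)=(R/(x))(j)\leftrightarrow(-\infty,-j)$. Arcs $(a,b),(c,d)$ cross if $a<c<b<d$ or $c<a<d<b$; a triangulation is a maximal set of pairwise non-crossing arcs. A right fountain at $a$ is $\{(a,b_i)\}_{i\in\mathbb{N}}$ with $(b_i)$ strictly increasing, a left fountain at $a$ is $\{(b_i,a)\}_{i\in\mathbb{N}}$ with $(b_i)$ strictly decreasing, a fountain at $a$ is the union of both. Subcategories are full, additive, closed under isomorphisms and summands. $\mathcal{T}$ is cluster tilting if it is functorially finite and $\{M\in\mathcal{C}_2\mid\mathrm{Ext}^1(\mathcal{T},M)=0\}=\mathcal{T}=\{M\in\mathcal{C}_2\mid\mathrm{Ext}^1(M,\mathcal{T})=0\}$. *)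

(* Defs.v *)
(* Graded modules over R = C[x,y]/(x^2) (deg x = 1, deg y = -1)
   encoded as Z-indexed families of finite-dimensional C-vector spaces with
   the actions of x and y (row-vector convention: v |-> v *m A). *)
From HB Require Import structures.
From mathcomp Require Import all_boot all_order all_algebra.
From mathcomp Require Import complex.
From mathcomp Require Import Rstruct.
Set Implicit Arguments. Unset Strict Implicit. Unset Printing Implicit Defensive.
Import Order.TTheory GRing.Theory Num.Theory.
Local Open Scope ring_scope.

Definition CC : fieldType := (Rdefinitions.R)[i].

Record grmod := GrMod {
  gdim : int -> nat;
  gx : forall n : int, 'M[CC]_(gdim n, gdim (n + 1));
  gy : forall n : int, 'M[CC]_(gdim (n + 1), gdim n) }.

Definition is_grmod (M : grmod) : Prop :=
  forall n : int,
    gx M n *m gx M (n + 1) = 0 /\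
    gx M (n + 1) *m gy M (n + 1) = gy M n *m gx M n.

Definition ghom (M N : grmod) := forall n : int, 'M[CC]_(gdim M n, gdim N n).

Definition is_ghom (M N : grmod) (f : ghom M N) : Prop :=
  forall n : int,
    gx M n *m f (n + 1) = f n *m gx N n /\
    gy M n *m f n = f (n + 1) *m gy N n.

Definition is_subgrmod (M : grmod) (U : forall n : int, 'M[CC]_(gdim M n)) :=
  forall n : int,
    (U n *m gx M n <= U (n + 1)%R)%MS /\ (U (n + 1)%R *m gy M n <= U n)%MS.

Definition fin_gen (M : grmod) : Prop :=
  exists (k : nat) (deg : 'I_k -> int) (g : forall i : 'I_k, 'rV[CC]_(gdim M (deg i))),
    forall U, is_subgrmod U -> (forall i, (g i <= U (deg i))%MS) ->
      forall n, (1%:M <= U n)%MS.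

(* maximal Cohen--Macaulay (R has dimension 1): depth >= 1, i.e.
   Hom_R(k, M) = 0: no nonzero homogeneous element killed by x and y. *)
Definition is_MCM (M : grmod) : Prop :=
  forall (n : int) (v : 'rV[CC]_(gdim M (n + 1))),
    v *m gx M (n + 1) = 0 -> v *m gy M n = 0 -> v = 0.

Definition in_C2 (M : grmod) : Prop := is_grmod M /\ fin_gen M /\ is_MCM M.

Definition giso (M N : grmod) : Prop :=
  exists (f : ghom M N) (g : ghom N M), is_ghom f /\ is_ghom g /\
    forall n, f n *m g n = 1%:M /\ g n *m f n = 1%:M.

Definition zero_grmod : grmod :=
  @GrMod (fun _ => 0%N) (fun _ => 0) (fun _ => 0).

Definition dsum (M N : grmod) : grmod :=
  @GrMod (fun n => (gdim M n + gdim N n)%N)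
    (fun n => block_mx (gx M n) 0 0 (gx N n))
    (fun n => block_mx (gy M n) 0 0 (gy N n)).

Definition is_subcat (P : grmod -> Prop) : Prop :=
  (forall M, P M -> in_C2 M) /\
  P zero_grmod /\
  (forall M N, P M -> P N -> P (dsum M N)) /\
  (forall M N, P M -> in_C2 N -> giso M N -> P N) /\
  (forall M N, P (dsum M N) -> P M /\ P N).

Definition is_ses (A B E : grmod) (i : ghom B E) (p : ghom E A) : Prop :=
  forall n, row_free (i n) /\ row_full (p n) /\ (i n == kermx (p n))%MS.

Definition Ext1_zero (A B : grmod) : Prop :=
  forall (E : grmod) (i : ghom B E) (p : ghom E A),
    in_C2 E -> is_ghom i -> is_ghom p -> is_ses i p ->
    exists s : ghom A E, is_ghom s /\ forall n, s n *m p n = 1%:M.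

Definition contravariantly_finite (P : grmod -> Prop) : Prop :=
  forall M, in_C2 M -> exists (T0 : grmod) (f : ghom T0 M),
    P T0 /\ is_ghom f /\
    forall (T : grmod) (g : ghom T M), P T -> is_ghom g ->
      exists h : ghom T T0, is_ghom h /\ forall n, g n = h n *m f n.

Definition covariantly_finite (P : grmod -> Prop) : Prop :=
  forall M, in_C2 M -> exists (T0 : grmod) (f : ghom M T0),
    P T0 /\ is_ghom f /\
    forall (T : grmod) (g : ghom M T), P T -> is_ghom g ->
      exists h : ghom T0 T, is_ghom h /\ forall n, g n = f n *m h n.

Definition functorially_finite (P : grmod -> Prop) : Prop :=
  contravariantly_finite P /\ covariantly_finite P.

Definition cluster_tilting (P : grmod -> Prop) : Prop :=
  functorially_finite P /\
  (forall M, in_C2 M -> (P M <-> forall T, P T -> Ext1_zero T M)) /\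
  (forall M, in_C2 M -> (P M <-> forall T, P T -> Ext1_zero M T)).

(* (x, y^k)(j): in degree m = j+n, basis x y^(1-m) (index 0, when m <= 1)
   and y^(-m) (index 1, when m <= -k). *)
Definition ideal_mod (k : nat) (j : int) : grmod :=
  @GrMod (fun n => if j + n <= 1 then (if j + n <= - (k%:Z) then 2%N else 1%N) else 0%N)
    (fun n => \matrix_(r, c) ((r == 1%N :> nat) && (c == 0%N :> nat))%:R)
    (fun n => \matrix_(r, c) (r == c :> nat)%:R).

(* C[y](j) = (R/(x))(j): in degree m = j+n, basis y^(-m) when m <= 0 *)
Definition Cy_mod (j : int) : grmod :=
  @GrMod (fun n => if j + n <= 0 then 1%N else 0%N)
    (fun n => 0)
    (fun n => \matrix_(r, c) (r == c :> nat)%:R).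

(* endpoint in Z u {-oo}: None = -oo *)
Definition arc := (option int * int)%type.

Definition ltE (u v : option int) : bool :=
  match u, v with
  | None, None => false
  | None, Some _ => true
  | Some _, None => false
  | Some a, Some b => a < b
  end.

Definition valid_arc (al : arc) : Prop := ltE al.1 (Some al.2).

Definition crossing (al be : arc) : Prop :=
  let: (a, b) := al in let: (c, d) := be in
  (ltE a c /\ ltE c (Some b) /\ b < d) \/ (ltE c a /\ ltE a (Some d) /\ d < b).

Definition triangulation (S : arc -> Prop) : Prop :=
  (forall al, S al -> valid_arc al) /\
  (forall al be, S al -> S be -> ~ crossing al be) /\
  (forall al, valid_arc al -> (forall be, S be -> ~ crossing al be) -> S al).

Definition has_fountain (S : arc -> Prop) (a : int) : Prop :=
  (exists b : nat -> int, (forall i, b i < b i.+1) /\ forall i, S (Some a, b i)) /\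
  (exists b : nat -> int, (forall i, b i.+1 < b i) /\ forall i, S (Some (b i), a)).

(* (x,y^k)(j) <-> (-j-k, 1-j);  C[y](j) <-> (-oo, -j) *)
Definition arc_mod (al : arc) : grmod :=
  match al with
  | (Some a, b) => ideal_mod (absz (b - a - 1)%R) (1 - b)%R
  | (None, b) => Cy_mod (- b)%R
  end.

Definition arcs_of (P : grmod -> Prop) : arc -> Prop :=
  fun al => valid_arc al /\ P (arc_mod al).

(* Main.v *)
Require Import Defs.
From mathcomp Require Import all_boot all_order all_algebra zify.
From Stdlib Require Import Classical IndefiniteDescription.
Set Implicit Arguments. Unset Strict Implicit. Unset Printing Implicit Defensive.
Import Order.TTheory GRing.Theory Num.Theory.
Local Open Scope ring_scope.

(** Since y is a nonzerodivisor on a module M of C_2, all degrees of M embed in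
    V = M[1/y]_0; thus M is a finite dimensional space V with a decreasing filtration
    and an operator N = xy such that N^2 = 0 and N raises the filtration degree.
    The arc (a, b) is the space with basis v, Nv of levels a and b, and (-oo, b) is a
    line of level b.  Every object is a sum of arcs: take v with Nv <> 0 of maximal
    level a and let b be the level of Nv; then (v, Nv) is a direct summand.
    An extension is a cocycle D with N D + D N = 0 modulo N H - H N, so that
    Ext^1 between arcs is nonzero iff they cross, or both are limit arcs (-oo, b),
    (-oo, d) with b < d.  Hence a cluster tilting subcategory gives a triangulation with at most
    one limit arc, and maximality makes a limit arc (-oo, a) force a fountain at a.
    Without limit arc there is no right approximation of (-oo, 0): a map from (c, d)
    onto it factors only through arcs ending at d or later, whereas the d with c <= 0 are
    then unbounded.  Conversely, with a fountain at a, approximations of an arc need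
    only finitely many arcs of the triangulation besides (-oo, a). *)

(** The end points of an arc are levels because the generators y^k and x of (x, y^k)(j) live in
    degrees -j-k and 1-j, and after inverting y they become v and Nv. A morphism is then a matrix
    that commutes with N and whose entries vanish wherever they would lower the level, so factoring
    a map through an arc becomes a comparison of end points.

    Functorial finiteness is tied to the fountain by the following obstacle. The arcs (c, d) with c
    <= f all map onto (-oo, f), and when their right ends d are unbounded no finite sum of finite
    arcs dominates them. A limit arc (-oo, a) with a <= f absorbs all those with c <= a, and the
    right fountain forces every sufficiently long one to satisfy c <= a. The left fountain plays the
    dual role.

    A second obstacle is that limit arcs never cross and yet extend each other in one direction, so
    rigid and non-crossing differ. A fountain at a removes the difference, since it crosses every
    limit arc except (-oo, a). In the other direction, the left and the right Ext-condition take
    care of limit arcs on the two sides of the given one. *)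

(** Serves to build the embeddings of all degrees at once. The type varies with the degree and
    equalities such as n0 + k + 1 = n0 + k.+1 are not conversions, hence the transports [cst], which
    all agree by irrelevance of equality proofs on [int]. *)
Lemma int_dep_rec (T : int -> Type) (n0 : int) (x0 : T n0)
    (up : forall n, T n -> T (n + 1)) (down : forall n, T (n + 1) -> T n) :
  exists phi : forall n, T n, phi n0 = x0 /\
    (forall n, n0 <= n -> phi (n + 1) = up n (phi n)) /\
    (forall n, n < n0 -> phi n = down n (phi (n + 1))).
Proof.
pose cst n m (e : n = m) (x : T n) : T m := eq_rect n T x m e.
have cst_id n (e : n = n) x : cst n n e x = x.
  by rewrite (eq_irrelevance e (erefl n)).
have cst_comp n m p (e1 : n = m) (e2 : m = p) (e3 : n = p) x :
    cst m p e2 (cst n m e1 x) = cst n p e3 x.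
  by case: _ / e2 e3 => e3; rewrite cst_id (eq_irrelevance e1 e3).
have e0 : n0 = n0 + 0%:Z by lia.
have eS (k : nat) : n0 + k%:Z + 1 = n0 + k.+1%:Z by lia.
have e0' : n0 = n0 - 0%:Z by lia.
have eS' (k : nat) : n0 - k%:Z = n0 - k.+1%:Z + 1 by lia.
pose fup := fix fup (k : nat) : T (n0 + k%:Z) :=
  if k is k'.+1 then cst _ _ (eS k') (up _ (fup k')) else cst _ _ e0 x0.
pose fdn := fix fdn (k : nat) : T (n0 - k%:Z) :=
  if k is k'.+1 then down _ (cst _ _ (eS' k') (fdn k')) else cst _ _ e0' x0.
have p1 n : n0 <= n -> n0 + `|n - n0|%N%:Z = n by lia.
have p2 n : (n0 <= n) = false -> n0 - `|n0 - n|%N%:Z = n by lia.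
pose phi n : T n := match (n0 <= n) as b return (n0 <= n) = b -> T n with
  | true => fun h => cst _ _ (p1 n h) (fup _)
  | false => fun h => cst _ _ (p2 n h) (fdn _) end erefl.
have phiup (k : nat) n (e : n0 + k%:Z = n) : phi n = cst _ _ e (fup k).
  have h : n0 <= n by lia.
  rewrite /phi; move: (erefl (n0 <= n)); rewrite {2 3}h => h'.
  have ek : `|n - n0|%N = k by lia.
  by move: (p1 n h'); rewrite ek => e'; congr (cst _ _ _ _); apply: eq_irrelevance.
have phidn (k : nat) n (e : n0 - k%:Z = n) : phi n = cst _ _ e (fdn k).
  case: (boolP (n0 <= n)) => [h|/negbTE h].
    (* The upward and the downward description overlap only at [n0], where both reduce to [x0]. *)
    have ek : k = 0%N by lia.
    subst k; have e1 : n0 + 0%:Z = n by lia.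
    rewrite (phiup _ _ e1) /=.
    have en : n0 = n by lia.
    by rewrite !(cst_comp _ _ _ _ _ en).
  rewrite /phi; move: (erefl (n0 <= n)); rewrite {2 3}h => h'.
  have ek : `|n0 - n|%N = k by lia.
  by move: (p2 n h'); rewrite ek => e'; congr (cst _ _ _ _); apply: eq_irrelevance.
exists phi; split; last split.
- have e : n0 + 0%:Z = n0 by lia.
  by rewrite (phiup _ _ e) /= (cst_comp _ _ _ _ _ erefl).
- move=> n h.
  have [k ek] : exists k : nat, n0 + k%:Z = n by exists `|n - n0|%N; lia.
  subst n; have e : n0 + k.+1%:Z = n0 + k%:Z + 1 by lia.
  rewrite (phiup k _ erefl) (phiup _ _ e) /=.
  by move: (eS k) e; case: _ / => e; rewrite cst_id.
- move=> n h.
  have [k ek] : exists k : nat, n0 - k.+1%:Z = n.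
    by exists `|n0 - n|%N.-1; lia.
  subst n; rewrite (phidn k.+1 _ erefl) /=.
  by rewrite (phidn _ _ (eS' k)).
Qed.

Lemma row_freeI m n (A : 'M[CC]_(m, n)) :
  (forall u : 'rV_m, u *m A = 0 -> u = 0) -> row_free A.
Proof.
move=> h; rewrite -kermx_eq0; apply/eqP/row_matrixP => i.
by rewrite row0; apply: h; rewrite -row_mul mulmx_ker row0.
Qed.

Lemma fin_bound k (f : 'I_k -> int) : exists D : nat, forall i, `|f i| <= D%:Z.
Proof.
exists (\max_(i < k) `|f i|%N) => i.
have : (`|f i| <= \max_(i < k) `|f i|)%N by apply: (@leq_bigmax _ (fun i => `|f i|%N)).
by move: (\max_(_ < _) _)%N => m; lia.
Qed.

Lemma row_full_cancel m n p (A : 'M[CC]_(m, n)) (B C : 'M_(n, p)) :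
  row_full A -> A *m B = A *m C -> B = C.
Proof. by move=> h e; rewrite -[B]mul1mx -[C]mul1mx -(mulVpmx h) -!mulmxA e. Qed.

(** * Degreewise consequences of depth and finite generation *)

(** If y kills u, then both y and x kill ux, the latter because x^2 = 0. Depth gives ux = 0, and
    then u = 0. *)
Lemma gy_row_free M : is_grmod M -> is_MCM M -> forall n, row_free (gy M n).
Proof.
move=> gM cM n; apply: row_freeI => u uy.
have [_ e1] := gM n; have [e2 _] := gM (n + 1).
apply: (cM n) => //.
apply: (cM (n + 1)); first by rewrite -mulmxA e2 mulmx0.
by rewrite -mulmxA e1 mulmxA uy mul0mx.
Qed.

Lemma fin_gen_bounded_above M :
  is_grmod M -> fin_gen M -> exists D : int, forall n, D < n -> gdim M n = 0%N.
Proof.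
move=> gM [k [deg [g h]]]; have [D hD] := fin_bound deg.
(* The generators lie in degrees at most D. Only x raises the degree, and x^2 = 0, so nothing lies
   beyond D + 1. In degree D + 1 the kernel of x is taken: it contains the image of x and keeps [U]
   stable under x. *)
pose U n : 'M[CC]_(gdim M n) :=
  if n <= D%:Z then 1%:M else if n <= D%:Z + 1 then kermx (gx M n) else 0.
have sU : is_subgrmod U.
  move=> n; split; last first.
    rewrite /U; case: ifP => h1; case: (ifP (n <= _)) => h2; rewrite ?submx1 //; try lia.
    by case: ifP => h3; rewrite ?mul0mx ?sub0mx //; lia.
  rewrite /U; case: ifP => h1; case: (ifP (n + 1 <= _)) => h2; rewrite ?submx1 //; try lia.
    rewrite ifT; last by lia.
    by apply/sub_kermxP; rewrite mul1mx; case: (gM n).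
  case: ifP => h3; last by rewrite mul0mx sub0mx.
  by rewrite mulmx_ker sub0mx.
exists (D%:Z + 1) => n hn.
have hU : forall i, (g i <= U (deg i))%MS.
  by move=> i; rewrite /U ifT ?submx1 //; have := hD i; lia.
have := h U sU hU n; rewrite /U !ifF; try lia.
by rewrite submx0 -mxrank_eq0 mxrank1 => /eqP.
Qed.

(** Used to test generation in a single degree. Since the type depends on the degree, [W] has to be
    transported along a proof of n0 = n. *)
Lemma one_degree_sub (d : int -> nat) n0 (W : 'M[CC]_(d n0)) :
  exists U : forall n, 'M[CC]_(d n), U n0 = W /\ forall n, n != n0 -> U n = 1%:M.
Proof.
exists (fun n => match n0 =P n with
  | ReflectT e => eq_rect n0 (fun n => 'M[CC]_(d n)) W n e
  | ReflectF _ => 1%:M end); split.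
  by case: eqP => // e; rewrite (eq_irrelevance e (erefl n0)).
by move=> n ne; case: eqP => // e; rewrite -e eqxx in ne.
Qed.

(** Below all generators M = yM + xM. Inserting this once into xM gives xM = xyM + x^2 M, which lies
    in yM. *)
Lemma fin_gen_gy_full M : is_grmod M -> fin_gen M ->
  exists n0 : int, forall n, n <= n0 -> row_full (gy M n).
Proof.
move=> gM [k [deg [g h]]]; have [D hD] := fin_bound deg.
(* The submodule equal to yM + xM in degree n + 1 and to M elsewhere contains all generators,
   because the bound on n puts degree n + 1 strictly below them. *)
have gen n : n < - D%:Z - 1 -> (1%:M <= gy M (n + 1) + gx M n)%MS.
  move=> hn; have [U [U1 U2]] := one_degree_sub (gy M (n + 1) + gx M n)%MS.
  rewrite -U1; apply: h => [m|i]; last first.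
    by rewrite U2 ?submx1 //; apply/eqP => e; have := hD i; lia.
  split; last first.
    have [->|m1] := eqVneq m (n + 1); last by rewrite (U2 m) ?submx1.
    by rewrite U1; apply: (submx_trans (submxMl _ _)); apply: addsmxSl.
  have [e|m1] := eqVneq m n; last first.
    by rewrite (U2 (m + 1)) ?submx1 // (inj_eq (addIr _)).
  by rewrite e U1; apply: (submx_trans (submxMl _ _)); apply: addsmxSr.
exists (- D%:Z - 2) => m hm.
have [n em] : exists n, m = n + 1 + 1 by exists (m - 2); lia.
rewrite {m}em in hm *.
rewrite -sub1mx; apply: (submx_trans (gen (n + 1) _)); first lia.
rewrite addsmx_sub submx_refl /=.
have gn : (1%:M <= gy M (n + 1) + gx M n)%MS by apply: gen; lia.
have := submxMr (gx M (n + 1)) gn.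
rewrite mul1mx => /submx_trans; apply; rewrite addsmxMr addsmx_sub.
have [e1 _] := gM n; have [_ e2] := gM (n + 1).
by rewrite e1 sub0mx andbT -e2 submxMl.
Qed.

Lemma fin_gen_of_bounds M (n0 D : int) :
  (forall n, D < n -> gdim M n = 0%N) ->
  (forall n, n < n0 -> row_full (gy M n)) -> fin_gen M.
Proof.
(* The degrees n0, ..., n0 + L - 1 contain every nonzero degree from n0 on. Their basis vectors
   generate, because lower degrees are reached from them by y. *)
move=> hD h0; pose L := `|D - n0|%N.+1.
pose T := {m : 'I_L & 'I_(gdim M (n0 + m%:Z))}.
exists #|{: T}|, (fun i => n0 + (tag (enum_val i : T) : nat)%:Z).
exists (fun i => delta_mx 0 (tagged (enum_val i : T))) => U sU hU.
have up n : n0 <= n -> (1%:M <= U n)%MS.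
  move=> hn; case: (ltP D n) => hn'.
    by apply/row_subP => i; exfalso; have := ltn_ord i; rewrite [X in (_ < X)%N](hD n).
  have [m em] : exists m : 'I_L, n = n0 + (m : nat)%:Z.
    have lt : (`|n - n0| < L)%N by rewrite /L; lia.
    by exists (Ordinal lt) => /=; lia.
  subst n; apply/row_subP => j; rewrite row1.
  pose tj : T := Tagged (fun m : 'I_L => 'I_(gdim M (n0 + m%:Z))) j.
  by have := hU (enum_rank tj); rewrite enum_rankK.
move=> n; case: (leP n0 n) => [/up //|hn].
have [k ek] : exists k : nat, n = n0 - k%:Z by exists `|n0 - n|%N; lia.
rewrite {}ek {hn}; elim: k => [|k IH]; first by rewrite subr0; apply: up.
have e : n0 - k%:Z = n0 - k.+1%:Z + 1 by lia.
rewrite e in IH; case: (sU (n0 - k.+1%:Z)) => _ le.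
apply: submx_trans le; have := submxMr (gy M (n0 - k.+1%:Z)) IH.
rewrite mul1mx => /(submx_trans _); apply; rewrite sub1mx.
by apply: h0; lia.
Qed.

(** * Embedding into the localization at y *)

Lemma int_up_ind (n0 : int) (P : int -> Prop) :
  P n0 -> (forall n, n0 <= n -> P n -> P (n + 1)) -> forall n, n0 <= n -> P n.
Proof.
move=> P0 PS n hn; have [k ->] : exists k : nat, n = n0 + k%:Z by exists `|n - n0|%N; lia.
elim: k => [|k IH]; first by rewrite addr0.
have -> : n0 + k.+1%:Z = n0 + k%:Z + 1 by lia.
by apply: PS => //; lia.
Qed.

Lemma int_down_ind (n0 : int) (P : int -> Prop) :
  P n0 -> (forall n, n < n0 -> P (n + 1) -> P n) -> forall n, n <= n0 -> P n.
Proof.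
move=> P0 PS n hn; have [k ->] : exists k : nat, n = n0 - k%:Z by exists `|n0 - n|%N; lia.
elim: k => [|k IH]; first by rewrite subr0.
apply: PS; first lia.
by have -> : n0 - k.+1%:Z + 1 = n0 - k%:Z by lia.
Qed.

Lemma row_free_mul m n p (A : 'M[CC]_(m, n)) (B : 'M_(n, p)) :
  row_free A -> row_free B -> row_free (A *m B).
Proof. by move=> fA fB; rewrite /row_free mxrankMfree. Qed.

Lemma mulmx_pinvK m n p (A : 'M[CC]_(m, n)) (B : 'M_(m, p)) :
  row_free A -> A *m (pinvmx A *m B) = B.
Proof. by move=> fA; rewrite mulmxA mulmxVp // mul1mx. Qed.

(* All degrees of [M] are compared inside one vector space [M[1/y]_0],
   on which [N] is the action of [xy]. *)
Definition emb (M : grmod) r (N : 'M[CC]_r) (phi : forall n, 'M[CC]_(gdim M n, r)) : Prop :=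
  [/\ forall n, row_free (phi n),
      forall n, gy M n *m phi n = phi (n + 1)
    & forall n, gx M n *m phi (n + 1) = phi n *m N].

Definition exhausting (M : grmod) r (phi : forall n, 'M[CC]_(gdim M n, r)) : Prop :=
  exists n0 : int, forall n, n <= n0 -> row_full (phi n).

(** From some degree n0 downwards y is bijective, so the degree n0 part already is the localization.
    The embedding multiplies by powers of y above n0 and by inverse powers below. *)
Lemma C2_emb M : in_C2 M ->
  exists r (N : 'M[CC]_r) (phi : forall n, 'M[CC]_(gdim M n, r)),
    emb N phi /\ exhausting phi.
Proof.
move=> [gM [fM cM]]; have yf := gy_row_free gM cM.
have [n0 yF] := fin_gen_gy_full gM fM.
have [phi [phi0 [phiU phiD]]] :=
  @int_dep_rec (fun n => 'M[CC]_(gdim M n, gdim M n0)) n0 1%:M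
    (fun n p => gy M n *m p) (fun n p => pinvmx (gy M n) *m p).
have py n : gy M n *m phi n = phi (n + 1).
  case: (leP n0 n) => hn; first by rewrite phiU.
  by rewrite phiD // mulmxA mulmxVp // mul1mx.
have up : forall n, n0 <= n -> row_free (phi n).
  apply: int_up_ind; first by rewrite phi0 row_free_unit unitmx1.
  by move=> n hn IH; rewrite phiU // row_free_mul.
have dn : forall n, n <= n0 -> row_free (phi n) /\ row_full (phi n).
  apply: int_down_ind => [|n hn [IH1 IH2]].
    by rewrite phi0 row_free_unit row_full_unit unitmx1.
  split.
    apply: row_freeI => u; rewrite phiD // mulmxA => e.
    have e0 : u *m pinvmx (gy M n) = 0.
      by apply: (row_free_inj IH1); rewrite mul0mx.
    by rewrite -[u]mulmx1 -(mulVpmx (yF n (ltW hn))) mulmxA e0 mul0mx.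
  by rewrite -sub1mx; apply: submx_trans (submxMl (gy M n) _); rewrite py sub1mx.
have [n1F n0F] := dn n0 (lexx _).
(* [N] is read off in degree n0, where [phi] is the identity. Its relation to x spreads upwards
   since x and y commute, and downwards by cancelling the surjective y. *)
have [N pN0] : exists N, gx M n0 *m phi (n0 + 1) = phi n0 *m N.
  by exists (pinvmx (phi n0) *m (gx M n0 *m phi (n0 + 1))); rewrite mulmx_pinvK.
exists (gdim M n0), N, phi; split; last by exists n0 => n /dn[].
split => // n.
  by case: (leP n0 n) => [/up //|/ltW/dn[]].
case: (leP n0 n) => hn.
  move: n hn; apply: int_up_ind => // n hn IH.
  by have [_ e] := gM n; rewrite -py mulmxA e -mulmxA IH mulmxA py.
move: n {hn}(ltW hn); apply: int_down_ind => // n hn IH.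
apply: (row_full_cancel (yF n (ltW hn))).
by have [_ e] := gM n; rewrite !mulmxA -e -mulmxA py IH py.
Qed.

(** The restriction of [F] to degree n. As [pinvmx] inverts [phi' n] only on its row space, this
    reading is valid when [F] is [filtered]. *)
Definition mx_ghom (M M' : grmod) r r' (phi : forall n, 'M[CC]_(gdim M n, r))
    (phi' : forall n, 'M[CC]_(gdim M' n, r')) (F : 'M[CC]_(r, r')) : ghom M M' :=
  fun n => phi n *m F *m pinvmx (phi' n).

Definition filtered (M M' : grmod) r r' (phi : forall n, 'M[CC]_(gdim M n, r))
    (phi' : forall n, 'M[CC]_(gdim M' n, r')) (F : 'M[CC]_(r, r')) : Prop :=
  forall n, (phi n *m F <= phi' n)%MS.

Lemma mx_ghomE M M' r r' (phi : forall n, 'M[CC]_(gdim M n, r))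
    (phi' : forall n, 'M[CC]_(gdim M' n, r')) F : filtered phi phi' F ->
  forall n, mx_ghom phi phi' F n *m phi' n = phi n *m F.
Proof. by move=> h n; rewrite /mx_ghom mulmxKpV. Qed.

Lemma mx_ghomP M M' r r' (N : 'M_r) (N' : 'M_r') phi phi' F :
  @emb M r N phi -> @emb M' r' N' phi' -> filtered phi phi' F ->
  N *m F = F *m N' -> is_ghom (mx_ghom phi phi' F).
Proof.
move=> [f e g] [f' e' g'] hF c n; move: (mx_ghom _ _ _) (mx_ghomE hF) => t tE.
split; apply: (row_free_inj (f' _)).
  by rewrite -!mulmxA tE g' mulmxA g [RHS]mulmxA tE -!mulmxA c.
by rewrite -!mulmxA tE e' tE mulmxA e.
Qed.

(** One degree in which [phi] is invertible determines [F]. Higher degrees follow by multiplying by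
    y; lower ones by cancelling y, which is onto there because two consecutive [phi] are
    invertible. *)
Lemma ghom_mx M M' r r' (N : 'M_r) (N' : 'M_r') phi phi' (f : ghom M M') :
  @emb M r N phi -> exhausting phi -> @emb M' r' N' phi' -> is_ghom f ->
  exists F : 'M[CC]_(r, r'), N *m F = F *m N' /\ filtered phi phi' F /\
    forall n, f n *m phi' n = phi n *m F.
Proof.
move=> [fr e g] [n0 full] [f' e' g'] hf.
have [F F0] : exists F, f n0 *m phi' n0 = phi n0 *m F.
  by exists (pinvmx (phi n0) *m (f n0 *m phi' n0)); rewrite mulmx_pinvK.
have fF n : f n *m phi' n = phi n *m F.
  case: (leP n0 n) => hn.
    move: n hn; apply: int_up_ind => // n hn IH.
    by have [_ h] := hf n; rewrite -e' mulmxA -h -e -!mulmxA IH.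
  move: n {hn}(ltW hn); apply: int_down_ind => // n hn IH.
  have yF : row_full (gy M n).
    have [h1 h2] : row_full (phi (n + 1)) /\ row_full (phi n).
      by split; apply: full; lia.
    have d1 := fr (n + 1); have d2 := fr n.
    rewrite /row_full -(mxrankMfree _ d2) e.
    by move: h1 h2 d1 d2; rewrite /row_full /row_free => /eqP-> /eqP-> _ /eqP->.
  apply: (row_full_cancel yF); have [_ h] := hf n.
  by rewrite !mulmxA h e -mulmxA e' IH.
exists F; split; last split => //; last by move=> n; rewrite -fF submxMl.
apply: (row_full_cancel (full n0 (lexx _))).
have [h _] := hf n0.
by rewrite !mulmxA -g -fF -[_ *m phi' _ *m N']mulmxA -g' [RHS]mulmxA -h -!mulmxA fF.
Qed.

(** * Filtered vector spaces with a nilpotent operator *)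

(* The basis vector of index [i] lies in the [n]-th filtration step iff [n <= lv i]. *)
Record fobj := FObj { rk : nat; nilp : 'M[CC]_rk; lv : 'I_rk -> int }.
Arguments lv : clear implicits.

Definition based (M : grmod) r (phi : forall n, 'M[CC]_(gdim M n, r)) (l : 'I_r -> int) :=
  forall n (u : 'rV_r), (u <= phi n)%MS <-> forall i, l i < n -> u 0 i = 0.

Definition realizes M X : Prop :=
  exists phi : forall n, 'M[CC]_(gdim M n, rk X), emb (nilp X) phi /\ based phi (lv X).

Definition is_fhom (X Y : fobj) (F : 'M[CC]_(rk X, rk Y)) : Prop :=
  nilp X *m F = F *m nilp Y /\ forall i j, lv Y j < lv X i -> F i j = 0.

Lemma based_exhausting M r (phi : forall n, 'M[CC]_(gdim M n, r)) l :
  based phi l -> exhausting phi.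
Proof.
move=> bs; have [D hD] := fin_bound l; exists (- D%:Z) => n hn.
rewrite -sub1mx; apply/row_subP => i; apply/bs => j hj.
by have := hD j; lia.
Qed.

Lemma based_bounded M r (phi : forall n, 'M[CC]_(gdim M n, r)) l :
  (forall n, row_free (phi n)) -> based phi l ->
  exists D : int, forall n, D < n -> gdim M n = 0%N.
Proof.
move=> f bs; have [D hD] := fin_bound l; exists D => n hn.
have := f n; suff -> : phi n = 0 by rewrite /row_free mxrank0 => /eqP.
apply/row_matrixP => i; apply/rowP => j; rewrite row0 [RHS]mxE.
have /bs : (row i (phi n) <= phi n)%MS by apply: row_sub.
by apply; have := hD j; lia.
Qed.

Lemma emb_mono M r (N : 'M_r) phi : @emb M r N phi ->
  forall m n, m <= n -> (phi n <= phi m)%MS.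
Proof.
move=> [_ e _] m; apply: int_up_ind => // n _ h.
by rewrite -e; apply: submx_trans h; apply: submxMl.
Qed.

Lemma delta_sub_based M r (phi : forall n, 'M[CC]_(gdim M n, r)) l i :
  based phi l -> ((delta_mx 0 i : 'rV_r) <= phi (l i))%MS.
Proof.
move=> bs; apply/bs => j hj; rewrite mxE eqxx /=.
by case: eqP => // e; move: hj; rewrite e ltxx.
Qed.

Lemma filtered_rows M M' r r' (phi : forall n, 'M[CC]_(gdim M n, r)) l
    (N' : 'M_r') (phi' : forall n, 'M[CC]_(gdim M' n, r')) F :
  based phi l -> emb N' phi' ->
  filtered phi phi' F <-> forall i, (row i F <= phi' (l i))%MS.
Proof.
move=> bs e'; split=> [h i|h n].
  rewrite rowE; apply: submx_trans (h (l i)).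
  by apply/submxMr/delta_sub_based.
apply/row_subP => k; rewrite row_mul mulmx_sum_row.
apply: summx_sub => i _; case: (ltP (l i) n) => hi.
  have /bs -> // : (row k (phi n) <= phi n)%MS by apply: row_sub.
  by rewrite scale0r sub0mx.
by apply: scalemx_sub; apply: submx_trans (h i) (emb_mono e' hi).
Qed.

Lemma filtered_based M M' r r' (phi : forall n, 'M[CC]_(gdim M n, r)) l
    (N' : 'M_r') (phi' : forall n, 'M[CC]_(gdim M' n, r')) l' F :
  based phi l -> emb N' phi' -> based phi' l' ->
  filtered phi phi' F <-> forall i j, l' j < l i -> F i j = 0.
Proof.
move=> bs e' bs'; rewrite (filtered_rows _ bs e'); split=> [h i j hij|h i].
  by have /bs' := h i => /(_ j hij); rewrite mxE.
by apply/bs' => j hij; rewrite mxE h.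
Qed.

(** Since [phi] is injective, the module relations may be checked inside the ambient space, where y
    is an inclusion and x acts as [N]. Finite generation holds because the filtration is zero in
    high degrees and everything in low ones. *)
Lemma emb_in_C2 M r (N : 'M_r) (phi : forall n, 'M[CC]_(gdim M n, r)) l :
  N *m N = 0 -> emb N phi -> based phi l -> in_C2 M.
Proof.
move=> N0 [f e g] bs; have [D hD] := based_bounded f bs.
have [n0 hn0] := based_exhausting bs.
have yf n : row_free (gy M n).
  apply: row_freeI => u u0; apply: (row_free_inj (f (n + 1))).
  by rewrite -e mulmxA u0 !mul0mx.
split; last split.
- move=> n; split.
    apply: (row_free_inj (f (n + 1 + 1))).
    by rewrite mul0mx -mulmxA g mulmxA g -mulmxA N0 mulmx0.
  apply: (row_free_inj (f (n + 1))).
  by rewrite -!mulmxA e !g [RHS]mulmxA e.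
- apply: (@fin_gen_of_bounds M (n0 - 1) D) => // n hn.
  have [h1 h2] : row_full (phi (n + 1)) /\ row_full (phi n).
    by split; apply: hn0; lia.
  have d1 := f (n + 1); have d2 := f n.
  rewrite /row_full -(mxrankMfree _ d2) e.
  by move: h1 h2 d1 d2; rewrite /row_full /row_free => /eqP-> /eqP-> _ /eqP->.
- move=> n v _ v0; apply: (row_free_inj (yf n)).
  by rewrite v0 mul0mx.
Qed.

(** * Direct sums and arc modules as filtered spaces *)

Definition fzero : fobj := @FObj 0 0 (fun _ => 0).

Definition fsum (X Y : fobj) : fobj :=
  @FObj (rk X + rk Y) (block_mx (nilp X) 0 0 (nilp Y))
    (fun i => match split i with inl j => lv X j | inr j => lv Y j end).

(* For [(a, b)]: index 1 is [v], of level [a], and index 0 is [v N], of level [b]. *)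
Definition arc_obj (al : Defs.arc) : fobj :=
  match al with
  | (Some a, b) => @FObj 2 (\matrix_(i, j) ((i == 1 :> nat) && (j == 0 :> nat))%:R)
                     (fun i => if i == 0 then b else a)
  | (None, b) => @FObj 1 0 (fun _ => b)
  end.

Lemma lv_lshift X Y i : lv (fsum X Y) (lshift (rk Y) i) = lv X i.
Proof. by rewrite /= (unsplitK (inl i)). Qed.

Lemma lv_rshift X Y i : lv (fsum X Y) (rshift (rk X) i) = lv Y i.
Proof. by rewrite /= (unsplitK (inr i)). Qed.

Lemma fsum_ind X Y (P : 'I_(rk (fsum X Y)) -> Prop) :
  (forall i, P (lshift (rk Y) i)) -> (forall i, P (rshift (rk X) i)) -> forall i, P i.
Proof.
by move=> h1 h2 i; rewrite -(@splitK (rk X) (rk Y) i); case: (split i) => j /=.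
Qed.

(** The embedding of M is assembled from the two projections [r] and [q], while the sections [i] and
    [k] lift vectors back. The form fits both formal direct sums and the complement of a split
    summand. *)
Lemma realizes_split A K M X Y (i : ghom A M) (r : ghom M A) (k : ghom K M) (q : ghom M K) :
  is_ghom r -> is_ghom q ->
  (forall n, i n *m r n = 1%:M) -> (forall n, k n *m q n = 1%:M) ->
  (forall n, i n *m q n = 0) -> (forall n, k n *m r n = 0) ->
  (forall n, r n *m i n + q n *m k n = 1%:M) ->
  realizes A X -> realizes K Y -> realizes M (fsum X Y).
Proof.
move=> hr hq ir kq iq kr rq [pA [[fA eA gA] bA]] [pK [[fK eK gK] bK]].
exists (fun n => row_mx (r n *m pA n) (q n *m pK n)); split; first split.
- move=> n; apply: row_freeI => u; rewrite mul_mx_row -[0]row_mx0 => /eq_row_mx[].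
  rewrite !mulmxA => e1 e2; rewrite -[u]mulmx1 -rq mulmxDr !mulmxA.
  have -> : u *m r n = 0 by apply: (row_free_inj (fA n)); rewrite mul0mx.
  have -> : u *m q n = 0 by apply: (row_free_inj (fK n)); rewrite mul0mx.
  by rewrite !mul0mx addr0.
- move=> n; rewrite mul_mx_row !mulmxA.
  have [_ ->] := hr n; have [_ ->] := hq n.
  by rewrite -!mulmxA eA eK.
- move=> n; rewrite mul_mx_row mul_row_block !mulmx0 addr0 add0r !mulmxA.
  have [-> _] := hr n; have [-> _] := hq n.
  by rewrite -!mulmxA gA gK.
- move=> n u; rewrite -[u]hsubmxK; set u1 := lsubmx u; set u2 := rsubmx u.
  have -> : (row_mx u1 u2 <= row_mx (r n *m pA n) (q n *m pK n))%MS <->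
      (u1 <= pA n)%MS /\ (u2 <= pK n)%MS.
    split.
      move=> /submxP[w]; rewrite mul_mx_row => /eq_row_mx[-> ->].
      by rewrite !mulmxA !submxMl.
    move=> [/submxP[w1 ->] /submxP[w2 ->]]; apply/submxP.
    exists (w1 *m i n + w2 *m k n); rewrite mul_mx_row !mulmxA !mulmxDl.
    rewrite -(mulmxA w1 _ (r n)) -(mulmxA w1 _ (q n)).
    rewrite -(mulmxA w2 _ (r n)) -(mulmxA w2 _ (q n)) ir kq iq kr.
    by rewrite !mulmx0 !mul0mx !mulmx1 addr0 add0r.
  rewrite bA bK; split=> [[h1 h2] | h].
    by apply: fsum_ind => j; rewrite (lv_lshift, lv_rshift) => hj;
      rewrite (row_mxEl, row_mxEr); auto.
  split=> j hj.
    by have := h (lshift _ j); rewrite lv_lshift row_mxEl; apply.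
  by have := h (rshift _ j); rewrite lv_rshift row_mxEr; apply.
Qed.

Lemma realizes_dsum A K X Y :
  realizes A X -> realizes K Y -> realizes (dsum A K) (fsum X Y).
Proof.
apply: (@realizes_split A K (dsum A K) X Y
  (fun n => row_mx 1%:M 0) (fun n => col_mx 1%:M 0)
  (fun n => row_mx 0 1%:M) (fun n => col_mx 0 1%:M)) => n /=.
- by split; rewrite mul_block_col mul_col_mx !mulmx1 !mulmx0 !mul0mx mul1mx ?addr0 ?add0r.
- by split; rewrite mul_block_col mul_col_mx !mulmx1 !mulmx0 !mul0mx mul1mx ?addr0 ?add0r.
- by rewrite mul_row_col mul1mx mul0mx addr0.
- by rewrite mul_row_col mul1mx mul0mx add0r.
- by rewrite mul_row_col mulmx0 mul0mx addr0.
- by rewrite mul_row_col mulmx0 mul0mx addr0.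
- by rewrite !mul_col_row !mul1mx !mul0mx add_block_mx !addr0 !add0r -scalar_mx_block.
Qed.

Lemma realizes_rank0 M (phi : forall n, 'M[CC]_(gdim M n, 0)) :
  emb 0 phi -> realizes M fzero.
Proof.
move=> e; exists phi; split; first exact: e.
by move=> n u; rewrite [u]thinmx0 sub0mx; split=> // _ [].
Qed.

Lemma realizes_zero : realizes zero_grmod fzero.
Proof.
apply: (@realizes_rank0 _ (fun n => 0)); split=> n; rewrite ?mulmx0 ?mul0mx //.
by rewrite /row_free mxrank0.
Qed.

(** Entries given by a relation on [nat] let pieces of one fixed pattern, with sizes varying with
    the degree, be multiplied. With [eq_op] it is a truncated identity. *)
Definition bool_mx (F : nzRingType) m n (f : rel nat) : 'M[F]_(m, n) := \matrix_(i, j) (f i j)%:R.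

Lemma bool_mx_mul_id (F : nzRingType) m n p (f : rel nat) :
  (forall i j, (i < m)%N -> (j < p)%N -> f i j -> (j < n)%N) ->
  bool_mx F m n f *m bool_mx F n p eq_op = bool_mx F m p f.
Proof.
move=> h; apply/matrixP => i j; rewrite !mxE.
case: (ltnP j n) => hj.
  rewrite (bigD1 (Ordinal hj)) //= !mxE eqxx mulr1 big1 ?addr0 // => k hk.
  by rewrite !mxE; case: eqP => [e|]; rewrite ?mulr0 // -val_eqE /= e eqxx in hk *.
rewrite [LHS]big1 => [|k _]; last first.
  by rewrite !mxE; case: eqP => [e|]; rewrite ?mulr0 //; have := ltn_ord k; lia.
case: (boolP (f i j)) => // /(h _ _ (ltn_ord i) (ltn_ord j)).
by rewrite ltnNge hj.
Qed.

Lemma bool_mx_id_mul (F : nzRingType) m n p (f : rel nat) :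
  (m <= n)%N -> bool_mx F m n eq_op *m bool_mx F n p f = bool_mx F m p f.
Proof.
move=> h; apply/matrixP => i j; rewrite !mxE.
rewrite (bigD1 (widen_ord h i)) //= !mxE eqxx mul1r big1 ?addr0 // => k hk.
rewrite !mxE; case: eqP => [e|]; rewrite ?mul0r //.
by rewrite -val_eqE /= e eqxx in hk.
Qed.

Lemma bool_mx_id_free (F : fieldType) m n : (m <= n)%N -> row_free (bool_mx F m n eq_op).
Proof.
move=> h; apply/row_freeP; exists (bool_mx F n m eq_op); rewrite bool_mx_id_mul //.
by apply/matrixP => i j; rewrite !mxE val_eqE.
Qed.

Lemma sub_bool_mx_id (F : fieldType) m n (u : 'rV[F]_n) : (m <= n)%N ->
  (u <= bool_mx F m n eq_op)%MS <-> forall i : 'I_n, (m <= i)%N -> u 0 i = 0.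
Proof.
move=> h; split=> [/submxP[w ->] i hi | hu].
  rewrite mxE big1 // => k _; rewrite mxE; case: eqP => [e|]; rewrite ?mulr0 //.
  by have := ltn_ord k; lia.
apply/submxP; exists (u *m bool_mx F n m eq_op); rewrite -mulmxA.
apply/rowP => j; rewrite mxE (bigD1 j) //=.
rewrite [X in _ + X]big1 ?addr0 => [|k hk]; last first.
  rewrite mxE big1 ?mulr0 // => l _; rewrite !mxE.
  case: eqP => [e1|]; rewrite ?mul0r //; case: eqP => [e2|]; rewrite ?mulr0 //.
  by rewrite -val_eqE /= e1 e2 eqxx in hk.
rewrite mxE; case: (ltnP j m) => hj; last by rewrite hu ?mul0r.
rewrite (bigD1 (Ordinal hj)) //= !mxE eqxx big1 ?addr0 ?mulr1 // => l hl.
by rewrite !mxE; case: eqP => [e|]; rewrite ?mul0r // -val_eqE /= e eqxx in hl *.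
Qed.

(** The basis of an arc module is ordered so that degree n is spanned by the first [d n] vectors:
    index 0 is present for n <= b, and index 1 for n <= a < b. So truncated identities give the
    embedding. *)
Lemma realizes_arc al : valid_arc al -> realizes (arc_mod al) (arc_obj al).
Proof.
case: al => [[a|] b] /=; rewrite /valid_arc /= => ab.
  pose d n := gdim (arc_mod (Some a, b)) n.
  have dE n : d n = if n <= b then if n <= a then 2%N else 1%N else 0%N.
    rewrite /d /=; have -> : (1 - b + n <= 1) = (n <= b) by lia.
    by have -> : (1 - b + n <= - (absz (b - a - 1)%R)%:Z) = (n <= a) by lia.
  have d2 n : (d n <= 2)%N by rewrite dE; case: ifP => //; case: ifP.
  exists (fun n => bool_mx CC (d n) 2 eq_op); split; first (split=> n).
  - exact: bool_mx_id_free.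
  - apply: (@bool_mx_id_mul _ (d (n + 1)) (d n) 2 eq_op).
    by rewrite !dE; do 4?[case: ifP]; lia.
  - rewrite (@bool_mx_mul_id _ (d n) (d (n + 1)) 2 (fun r c => (r == 1%N) && (c == 0%N))).
      by rewrite -(@bool_mx_id_mul _ (d n) 2 2).
    move=> i j hi _ /andP[/eqP ei /eqP ej]; rewrite ej; move: hi; rewrite ei !dE.
    by do 4?[case: ifP]; lia.
  - move=> n u; apply: (iff_trans (sub_bool_mx_id u (d2 n))); split=> h i hi; apply: h; move: hi.
      by rewrite dE; case: i => [[|[|//]]] /= _; do 4?[case: ifP]; lia.
    by rewrite dE; case: i => [[|[|//]]] /= _; do 4?[case: ifP]; lia.
pose d n := gdim (arc_mod (None, b)) n.
have dE n : d n = if n <= b then 1%N else 0%N.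
  by rewrite /d /=; have -> : (- b + n <= 0) = (n <= b) by lia.
have d1 n : (d n <= 1)%N by rewrite dE; case: ifP.
exists (fun n => bool_mx CC (d n) 1 eq_op); split; first (split=> n).
- exact: bool_mx_id_free.
- apply: (@bool_mx_id_mul _ (d (n + 1)) (d n) 1 eq_op).
  by rewrite !dE; do 4?[case: ifP]; lia.
- by rewrite mul0mx mulmx0.
move=> n u; apply: (iff_trans (sub_bool_mx_id u (d1 n))); split=> h i hi; apply: h; move: hi.
  by rewrite dE; case: i => [[|//]] /= _; case: ifP; lia.
by rewrite dE; case: i => [[|//]] /= _; case: ifP; lia.
Qed.

(** * Decomposition into arcs *)

(** Formal direct sums of arcs. The binary shape mirrors [fsum] and [dsum], so module and filtered
    space are interpretations of one tree by the same recursion. *)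
Inductive arc_tree := ATzero | ATarc of Defs.arc | ATsum of arc_tree & arc_tree.

Fixpoint fobj_of t :=
  match t with
  | ATzero => fzero
  | ATarc al => arc_obj al
  | ATsum t u => fsum (fobj_of t) (fobj_of u)
  end.

Fixpoint grmod_of t :=
  match t with
  | ATzero => zero_grmod
  | ATarc al => arc_mod al
  | ATsum t u => dsum (grmod_of t) (grmod_of u)
  end.

Fixpoint leaves (S : Defs.arc -> Prop) t : Prop :=
  match t with ATzero => True | ATarc al => S al | ATsum t u => leaves S t /\ leaves S u end.

Lemma leaves_sub S S' t : (forall al, S al -> S' al) -> leaves S t -> leaves S' t.
Proof. by move=> h; elim: t => //= t IHt u IHu [/IHt ? /IHu ?]. Qed.

Lemma realizes_tree t : leaves valid_arc t -> realizes (grmod_of t) (fobj_of t).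
Proof.
elim: t => [_|al|t IHt u IHu [/IHt ht /IHu hu]] /=.
- exact: realizes_zero.
- exact: realizes_arc.
- exact: realizes_dsum.
Qed.

Lemma mx_ghom_comp M M' M'' r r' r'' (phi : forall n, 'M[CC]_(gdim M n, r))
    (phi' : forall n, 'M[CC]_(gdim M' n, r')) (phi'' : forall n, 'M[CC]_(gdim M'' n, r'')) F G :
  (forall n, row_free (phi'' n)) -> filtered phi phi' F -> filtered phi' phi'' G ->
  forall n, mx_ghom phi phi' F n *m mx_ghom phi' phi'' G n = mx_ghom phi phi'' (F *m G) n.
Proof.
move=> f hF hG n; apply: (row_free_inj (f n)).
have hFG : filtered phi phi'' (F *m G).
  by move=> m; rewrite mulmxA; apply: submx_trans (hG m); apply: submxMr.
rewrite mx_ghomE //.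
have := mx_ghomE hG n; have := mx_ghomE hF n.
move: (mx_ghom _ _ F n) (mx_ghom _ _ G n) => t1 t2 e1 e2.
by rewrite -mulmxA e2 mulmxA e1 mulmxA.
Qed.

Lemma mx_ghom1 M r (phi : forall n, 'M[CC]_(gdim M n, r)) :
  (forall n, row_free (phi n)) -> forall n, mx_ghom phi phi 1%:M n = 1%:M.
Proof. by move=> f n; rewrite /mx_ghom mulmx1 mulmxVp. Qed.

Lemma int_max (P : int -> Prop) n0 D : P n0 -> (forall n, P n -> n <= D) ->
  exists m, P m /\ forall n, P n -> n <= m.
Proof.
move=> P0 hD; have [k ek] : exists k : nat, D - n0 <= k%:Z by exists `|D - n0|%N; lia.
elim: k n0 P0 ek => [|k IH] n0 P0 ek.
  by exists n0; split=> // n /hD; lia.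
case: (classic (exists n, n0 < n /\ P n)) => [[n [hn Pn]]|h].
  by apply: (IH n) => //; lia.
exists n0; split=> // n Pn; rewrite leNgt; apply/negP => hn.
by apply: h; exists n.
Qed.

(** The complement is the kernel of the retraction [r] with a basis chosen in each degree, and [q]
    is the projector 1 - ri written in that basis. *)
Lemma split_complement M A (i : ghom A M) (r : ghom M A) :
  in_C2 M -> is_ghom i -> is_ghom r -> (forall n, i n *m r n = 1%:M) ->
  exists K (k : ghom K M) (q : ghom M K),
    [/\ in_C2 K, is_ghom q, forall n, k n *m q n = 1%:M, forall n, i n *m q n = 0
      & (forall n, k n *m r n = 0) /\ forall n, r n *m i n + q n *m k n = 1%:M].
Proof.
move=> [gM [fM cM]] hi hr ir.
pose d n := \rank (kermx (r n)).
pose k n : 'M[CC]_(d n, gdim M n) := row_base (kermx (r n)).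
have kf n : row_free (k n) by apply: row_base_free.
have kr n : k n *m r n = 0 by apply/sub_kermxP; rewrite eq_row_base.
have [q qk] : exists q : forall n, 'M[CC]_(gdim M n, d n),
    forall n, q n *m k n = 1%:M - r n *m i n.
  exists (fun n => (1%:M - r n *m i n) *m pinvmx (k n)) => n.
  rewrite mulmxKpV // eq_row_base; apply/sub_kermxP.
  by rewrite mulmxBl mul1mx -mulmxA ir mulmx1 subrr.
have kq n : k n *m q n = 1%:M.
  apply: (row_free_inj (kf n)).
  by rewrite -mulmxA qk mulmxBr mulmx1 mul1mx mulmxA kr mul0mx subr0.
have iq n : i n *m q n = 0.
  apply: (row_free_inj (kf n)).
  by rewrite -mulmxA qk mulmxBr mulmx1 mulmxA ir mul1mx subrr mul0mx.
clearbody k.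
pose K := @GrMod d (fun n => k n *m gx M n *m q (n + 1)) (fun n => k (n + 1) *m gy M n *m q n).
have hk : @is_ghom K M k.
  move=> n; have [h1 h2] := hr n; split.
    rewrite /= -mulmxA qk mulmxBr mulmx1 -[_ *m (r _ *m _)]mulmxA.
    by rewrite [gx M n *m _]mulmxA h1 !mulmxA kr !mul0mx subr0.
  rewrite /= -mulmxA qk mulmxBr mulmx1 -[_ *m (r _ *m _)]mulmxA.
  by rewrite [gy M n *m _]mulmxA h2 !mulmxA kr !mul0mx subr0.
have hq : @is_ghom M K q.
  move=> n; have [h1 h2] := hi n; split.
    rewrite /= !mulmxA qk mulmxBl mul1mx mulmxBl -(mulmxA (r n)) -h1.
    by rewrite -!mulmxA iq !mulmx0 subr0.
  rewrite /= !mulmxA qk mulmxBl mul1mx mulmxBl -(mulmxA (r (n + 1))) -h2.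
  by rewrite -!mulmxA iq !mulmx0 subr0.
exists K, k, q; split=> //; last first.
  by split=> // n; rewrite qk addrC subrK.
have gK : is_grmod K.
  move=> n; have [e1 e2] := gM n; have [k1 k1'] := hk n; have [k2 k2'] := hk (n + 1).
  split.
    apply: (row_free_inj (kf (n + 1 + 1))).
    by rewrite mul0mx -mulmxA k2 mulmxA k1 -mulmxA e1 mulmx0.
  apply: (row_free_inj (kf (n + 1))).
  by rewrite -mulmxA k2' mulmxA k2 -mulmxA e2 -[RHS]mulmxA k1 [RHS]mulmxA k1' -mulmxA.
split=> //; split.
  have [D hD] := fin_gen_bounded_above gM fM; have [n0 h0] := fin_gen_gy_full gM fM.
  apply: (@fin_gen_of_bounds K n0 D) => // n hn.
    by apply/eqP; rewrite -leqn0 /= -[X in (_ <= X)%N](hD n hn) rank_leq_row.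
  have /row_fullP[B hB] := h0 n (ltW hn); apply/row_fullP.
  exists (k n *m B *m q (n + 1)); have [_ e] := hq n.
  have h : k n *m (B *m (gy M n *m q n)) = 1%:M by rewrite (mulmxA B) hB mul1mx kq.
  by move: h; rewrite e 2!mulmxA.
move=> n v v1 v2; apply: (row_free_inj (kf (n + 1))); rewrite mul0mx.
have [_ k1] := hk n; have [k2 _] := hk (n + 1).
apply: (cM n); first by rewrite -mulmxA -k2 mulmxA v1 mul0mx.
by rewrite -mulmxA -k1 mulmxA v2 mul0mx.
Qed.

Lemma col_mul m n p (A : 'M[CC]_(m, n)) (B : 'M_(n, p)) j : col j (A *m B) = A *m col j B.
Proof. by rewrite !colE mulmxA. Qed.

Lemma separating_functional m r (A : 'M[CC]_(m, r)) (w : 'rV_r) : ~~ (w <= A)%MS ->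
  exists la : 'cV_r, A *m la = 0 /\ w *m la = 1%:M.
Proof.
rewrite submxE => h.
have [j hj] : exists j, (w *m cokermx A) 0 j != 0.
  apply/existsP; apply: contraR h; rewrite negb_exists => /forallP h; apply/eqP/rowP => j.
  by have := h j ; rewrite negbK => /eqP ->; rewrite mxE.
exists (((w *m cokermx A) 0 j)^-1 *: col j (cokermx A)).
rewrite -!scalemxAr -!col_mul mulmx_coker; split.
  by apply/matrixP => a b; rewrite !mxE mulr0.
apply/matrixP => a b; rewrite !ord1 [LHS]mxE [col _ _ _ _]mxE mulVf //.
by rewrite mxE.
Qed.

(** The operator of a finite arc. The size 1 + 1 is convertible to 2 and makes block multiplication
    available. *)
Definition nil2 : 'M[CC]_(1 + 1) := block_mx 0 0 1%:M 0.

Lemma arc_obj_nil2 a b : nilp (arc_obj (Some a, b)) = nil2.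
Proof.
apply/matrixP => i j; rewrite mxE.
case: (@split_ordP 1 1 i) => i' ->; case: (@split_ordP 1 1 j) => j' ->;
  [rewrite [RHS]block_mxEul | rewrite [RHS]block_mxEur
  | rewrite [RHS]block_mxEdl | rewrite [RHS]block_mxEdr]; by rewrite !ord1 !mxE.
Qed.

(* A vector [v] with [v N != 0] whose level is maximal splits off together
   with [v N]: any functional separating [v N] from the next filtration step
   gives the retraction. *)
Lemma arc_summand M r (N : 'M_r) phi : in_C2 M -> @emb M r N phi -> exhausting phi ->
  (0 < r)%N -> exists al, valid_arc al /\
    exists (i : ghom (arc_mod al) M) (p : ghom M (arc_mod al)),
      [/\ is_ghom i, is_ghom p & forall n, i n *m p n = 1%:M].
Proof.
move=> [gM [fM _]] em ex r0; have [D hD] := fin_gen_bounded_above gM fM.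
have [f e g] := em; have [n0 full] := ex.
have top n : D < n -> forall w : 'rV_r, (w <= phi n)%MS -> w = 0.
  move=> hn w; suff -> : phi n = 0 by case/submxP=> z ->; rewrite mulmx0.
  by apply/eqP; rewrite -mxrank_eq0 -leqn0 -[X in (_ <= X)%N](hD n hn) rank_leq_row.
have topphi n : D < n -> phi n = 0.
  by move=> hn; apply/row_matrixP => k; rewrite row0; apply: (top n hn); apply: row_sub.
have N0 : N *m N = 0.
  apply: (row_full_cancel (full n0 (lexx _))); have [h _] := gM n0.
  by rewrite mulmx0 mulmxA -g -mulmxA -g mulmxA h mul0mx.
have lift al (F : 'M_(rk (arc_obj al), r)) (G : 'M_(r, rk (arc_obj al))) : valid_arc al ->
    nilp (arc_obj al) *m F = F *m N -> N *m G = G *m nilp (arc_obj al) -> F *m G = 1%:M ->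
    (forall i, (row i F <= phi (lv (arc_obj al) i))%MS) ->
    (forall n i, lv (arc_obj al) i < n -> phi n *m col i G = 0) ->
    exists al, valid_arc al /\ exists (i : ghom (arc_mod al) M) (p : ghom M (arc_mod al)),
      [/\ is_ghom i, is_ghom p & forall n, i n *m p n = 1%:M].
  move=> va cF cG FG hF hG; exists al; split=> //.
  have [pA [eA bA]] := realizes_arc va.
  have fF : filtered pA phi F by apply/(filtered_rows _ bA em).
  have fG : filtered phi pA G.
    move=> n; apply/row_subP => k; apply/bA => i hi.
    have := hG n i hi; rewrite -col_mul => /matrixP/(_ k 0).
    by rewrite mxE [RHS]mxE => h; rewrite mxE.
  exists (mx_ghom pA phi F), (mx_ghom phi pA G); split.
  - exact: mx_ghomP eA em fF cF.
  - exact: mx_ghomP em eA fG cG.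
  - have [fA _ _] := eA.
    by move=> n; rewrite mx_ghom_comp // FG mx_ghom1.
(* If N = 0, any nonzero vector of the last nonzero filtration step b spans a limit summand. A
   functional equal to 1 on it is filtered because nothing lies beyond b. *)
case: (eqVneq N 0) => [NE|NE].
  have [b [phib hb]] : exists b, phi b != 0 /\ forall n, phi n != 0 -> n <= b.
    apply: (@int_max _ n0 D) => [|n].
      apply: contraTneq (full n0 (lexx _)) => ->.
      by rewrite /row_full mxrank0; case: (r) r0.
    by move=> h; rewrite leNgt; apply: contra_neqN h => /topphi.
  have [k hk] : exists k, row k (phi b) != 0.
    apply/existsP; apply: contraR phib; rewrite negb_exists => /forallP h; apply/eqP/row_matrixP
      => k.
    by have := h k ; rewrite negbK => /eqP ->; rewrite row0.
  have [la [_ hla]] : exists la : 'cV_r, (0 : 'M_r) *m la = 0 /\ row k (phi b) *m la = 1%:M.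
    by apply: separating_functional; rewrite submx0.
  apply: (lift (None, b) (row k (phi b)) la) => //.
  - by rewrite NE mulmx0 mul0mx.
  - by rewrite NE mulmx0 mul0mx.
  - by move=> i; apply: submx_trans (row_sub _ _) (row_sub _ _).
  - move=> n i /= hn; have -> : phi n = 0; last by rewrite mul0mx.
    by apply/eqP; apply: contraTT hn => /hb; rewrite leNgt.
have [a [pNa ha]] : exists a, phi a *m N != 0 /\ forall n, phi n *m N != 0 -> n <= a.
  apply: (@int_max _ n0 D) => [|n].
    apply: contra_neq NE => h; apply: (row_full_cancel (full n0 (lexx _))).
    by rewrite h mulmx0.
  by move=> h; rewrite leNgt; apply: contra_neqN h => /topphi ->; rewrite mul0mx.
have pN n : a < n -> phi n *m N = 0.
  by move=> hn; apply/eqP; apply: contraTT hn => /ha; rewrite leNgt.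
have [k hk] : exists k, row k (phi a *m N) != 0.
  apply/existsP; apply: contraR pNa; rewrite negb_exists => /forallP h; apply/eqP/row_matrixP =>
    k.
  by have := h k ; rewrite negbK => /eqP ->; rewrite row0.
rewrite row_mul in hk; set v := row k (phi a) in hk.
have va : (v <= phi a)%MS by apply: row_sub.
have wa : (v *m N <= phi (a + 1)%R)%MS.
  by rewrite /v -row_mul -g row_mul submxMl.
have [b [wb hb]] : exists b, (v *m N <= phi b)%MS /\ forall n, (v *m N <= phi n)%MS -> n <= b.
  apply: (@int_max _ (a + 1) D) => // n hn; rewrite leNgt; apply: contra_neqN hk => hDn.
  exact: top hn.
have ab : a < b by have := hb _ wa; lia.
have [la0 [h1 h2]] : exists la : 'cV_r, phi (b + 1) *m la = 0 /\ v *m N *m la = 1%:M.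
  by apply: separating_functional; apply/negP => /hb; lia.
(* The correction makes [la] vanish on v, so that (la, N la) is dual to (vN, v). It still kills step
   b + 1, because N does: b + 1 exceeds a, the last level on which N is nonzero. *)
pose la := la0 - N *m la0 *m (v *m la0).
have vla : v *m la = 0 by rewrite /la mulmxBr !mulmxA h2 mul1mx subrr.
have wla : v *m N *m la = 1%:M.
  by rewrite /la mulmxBr h2 !mulmxA -(mulmxA v) N0 mulmx0 !mul0mx subr0.
have Nla : N *m N *m la = 0 by rewrite N0 mul0mx.
have pla : phi (b + 1) *m la = 0.
  by rewrite /la mulmxBr h1 !mulmxA pN ?mul0mx ?subr0 //; lia.
clearbody la.
apply: (lift (Some a, b) (col_mx (v *m N) v : 'M_(1 + 1, r)) (row_mx la (N *m la) : 'M_(r, 1 +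
  1))).
- exact: ab.
- have E : nil2 *m col_mx (v *m N) v = col_mx (v *m N) v *m N.
    rewrite /nil2 mul_block_col mul_col_mx !mul0mx mul1mx !addr0.
    by rewrite -mulmxA N0 mulmx0.
  by rewrite arc_obj_nil2; exact: E.
- have E : N *m row_mx la (N *m la) = row_mx la (N *m la) *m nil2.
    by rewrite /nil2 mul_mx_row mul_row_block mulmxA Nla !mulmx0 !mulmx1 !add0r.
  by rewrite arc_obj_nil2; exact: E.
- have E : col_mx (v *m N) v *m row_mx la (N *m la) = 1%:M.
    rewrite mul_col_row wla vla !mulmxA wla -(mulmxA v) N0 mulmx0 mul0mx.
    by rewrite -scalar_mx_block.
  exact: E.
- move=> i; have [->|->] : i = lshift 1 (0 : 'I_1) \/ i = rshift 1 (0 : 'I_1).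
  + by case: (@split_ordP 1 1 i) => j ->; rewrite ord1; auto.
  + have E : row (lshift 1 0) (col_mx (v *m N) v) = v *m N by rewrite rowKu row_id.
    by have := wb; rewrite -[X in (X <= _)%MS]E.
  + have E : row (rshift 1 0) (col_mx (v *m N) v) = v by rewrite rowKd row_id.
    by have := va; rewrite -[X in (X <= _)%MS]E.
- move=> n i; have [->|->] : i = lshift 1 (0 : 'I_1) \/ i = rshift 1 (0 : 'I_1).
  + by case: (@split_ordP 1 1 i) => j ->; rewrite ord1; auto.
  + move=> hn; have E : phi n *m col (lshift 1 0) (row_mx la (N *m la)) = 0.
      rewrite colKl col_id.
      have hbn : (phi n <= phi (b + 1)%R)%MS.
        by apply: (emb_mono em); move: hn => /=; lia.
      by have /submxP[z ->] := hbn; rewrite -mulmxA pla mulmx0.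
    exact: E.
  + move=> hn; have E : phi n *m col (rshift 1 0) (row_mx la (N *m la)) = 0.
      by rewrite colKr col_id mulmxA pN ?mul0mx.
    exact: E.
Qed.

Lemma arc_obj_rk_gt0 al : (0 < rk (arc_obj al))%N.
Proof. by case: al => [[a|] b]. Qed.

Lemma emb_rank M r (N : 'M_r) phi : @emb M r N phi -> exhausting phi ->
  exists n0 : int, forall n, n <= n0 -> gdim M n = r.
Proof.
move=> [f _ _] [n0 h]; exists n0 => n /h; have := f n.
by rewrite /row_free /row_full => /eqP e1 /eqP e2; apply: etrans (esym e1) e2.
Qed.

Lemma decompose M : in_C2 M -> exists t, leaves valid_arc t /\ realizes M (fobj_of t).
Proof.
move=> cM; have [r [N [phi [em ex]]]] := C2_emb cM.
move: {2}r (leqnn r) => d hd; elim: d r hd M cM N phi em ex => [|d IH] r hd M cM N phi em ex.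
  move: hd; rewrite leqn0 => /eqP r0; subst r; exists ATzero; split=> //.
  have N0 : N = 0 by apply/matrixP => -[].
  by apply: (@realizes_rank0 _ phi); rewrite -N0.
case: (posnP r) => [r0|r0]; first by apply: (IH r _ M cM N phi) => //; rewrite r0.
have [al [va [i [p [hi hp ip]]]]] := arc_summand cM em ex r0.
have [K [k [q [cK hq kq iq [kp pq]]]]] := split_complement cM hi hp ip.
have [r' [N' [phi' [em' ex']]]] := C2_emb cK.
(* The three ranks are dimensions in one common degree that is low enough. There the rank of the
   arc, which is positive, is lost in passing to K. *)
have r'd : (r' <= d)%N.
  have [n1 h1] := emb_rank em ex; have [n2 h2] := emb_rank em' ex'.
  have rA := realizes_arc va; have [pA [eA bA]] := rA.
  have [n3 h3] := emb_rank eA (based_exhausting bA).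
  pose n := Num.min n1 (Num.min n2 n3).
  have [d1 d2 d3] : [/\ gdim M n = r, gdim K n = r' & gdim (arc_mod al) n = rk (arc_obj al)].
    by split; [apply: h1 | apply: h2 | apply: h3]; rewrite /n; lia.
  have := mulmx0_rank_max (kp n).
  have /eqP -> : row_free (k n) by apply/row_freeP; exists (q n).
  have /eqP -> : row_full (p n) by apply/row_fullP; exists (i n).
  by rewrite d1 d2 d3; have := arc_obj_rk_gt0 al; lia.
have [t [vt rt]] := IH r' r'd K cK N' phi' em' ex'.
exists (ATsum (ATarc al) t); split=> //=.
exact: (realizes_split hp hq ip kq iq kp pq (realizes_arc va) rt).
Qed.

(** * Passing back from filtered spaces to modules *)

Definition square_zero (X : fobj) : Prop := nilp X *m nilp X = 0.

Lemma square_zero_tree t : square_zero (fobj_of t).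
Proof.
rewrite /square_zero; elim: t => [|[[a|] b]|t IHt u IHu].
- by apply/matrixP => -[].
- have E : nil2 *m nil2 = 0.
    by rewrite /nil2 mulmx_block !mulmx0 !mul0mx !addr0 ?mulmx1 block_mx0.
  by rewrite [fobj_of _]/(arc_obj (Some a, b)) arc_obj_nil2; exact: E.
- exact: mulmx0.
- have E : block_mx (nilp (fobj_of t)) 0 0 (nilp (fobj_of u)) *m block_mx (nilp (fobj_of t)) 0 0
  (nilp (fobj_of u)) = 0.
    by rewrite mulmx_block IHt IHu !mulmx0 !mul0mx !addr0 block_mx0.
  exact: E.
Qed.

Lemma realizes_in_C2 M X : square_zero X -> realizes M X -> in_C2 M.
Proof. by move=> fX [phi [e b]]; apply: emb_in_C2 fX e b. Qed.

(** The levels determine the filtration, so the identity matrix is filtered in both directions. *)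
Lemma realizes_giso M M' X : realizes M X -> realizes M' X -> giso M M'.
Proof.
move=> [p [e b]] [p' [e' b']].
have f1 : filtered p p' 1%:M.
  by move=> n; rewrite mulmx1; apply/row_subP => k; apply/b'; apply: (b n _).1; apply: row_sub.
have f2 : filtered p' p 1%:M.
  by move=> n; rewrite mulmx1; apply/row_subP => k; apply/b; apply: (b' n _).1; apply: row_sub.
have [fr _ _] := e; have [fr' _ _] := e'.
exists (mx_ghom p p' 1%:M), (mx_ghom p' p 1%:M); split; last split.
- by apply: mx_ghomP e e' f1 _; rewrite mulmx1 mul1mx.
- by apply: mx_ghomP e' e f2 _; rewrite mulmx1 mul1mx.
- by move=> n; rewrite !mx_ghom_comp // mulmx1 !mx_ghom1.
Qed.

Definition selmx (F : nzRingType) r (A : {pred 'I_r}) : 'M[F]_(#|A|, r) :=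
  \matrix_(k, j) (enum_val k == j)%:R.

Lemma selmx_out (F : nzRingType) r (A : {pred 'I_r}) k j : j \notin A -> selmx F A k j = 0.
Proof. by move=> hj; rewrite mxE; case: eqP => // e; rewrite -e enum_valP in hj. Qed.

Lemma selmx_tr (F : nzRingType) r (A : {pred 'I_r}) : selmx F A *m (selmx F A)^T = 1%:M.
Proof.
apply/matrixP => k l; rewrite !mxE (bigD1 (enum_val k)) //= !mxE eqxx mul1r.
rewrite (inj_eq enum_val_inj) [X in _ + X]big1 ?addr0 1?eq_sym // => j hj.
by rewrite mxE [_ == j]eq_sym (negbTE hj) mul0r.
Qed.

Lemma selmx_proj (F : nzRingType) r (A : {pred 'I_r}) m (B : 'M[F]_(m, r)) :
  (forall i j, j \notin A -> B i j = 0) -> B *m (selmx F A)^T *m selmx F A = B.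
Proof.
move=> hB; apply/matrixP => i j; rewrite -mulmxA mxE (bigD1 j) //=.
rewrite [X in _ + X]big1 ?addr0 => [|l hl]; last first.
  rewrite mxE big1 ?mulr0 // => k _; rewrite !mxE.
  case: eqP => [e1|]; rewrite ?mul0r //; case: eqP => [e2|]; rewrite ?mulr0 //.
  by rewrite -e1 -e2 eqxx in hl.
case: (boolP (j \in A)) => jA; last by rewrite hB ?mul0r.
rewrite mxE (bigD1 (enum_rank_in jA j)) //= !mxE enum_rankK_in // eqxx mulr1.
rewrite [X in _ + X]big1 ?addr0 ?mulr1 // => k hk; rewrite !mxE.
case: eqP => [e1|]; rewrite ?mul0r //.
suff ek : k = enum_rank_in jA j by rewrite ek eqxx in hk.
by apply: enum_val_inj; rewrite enum_rankK_in.
Qed.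

(** Degree n gets the basis vectors of level at least n. Cutting the image of N down to step n + 1
    loses nothing, because N raises levels strictly. *)
Lemma realizable X : (forall i j, lv X j <= lv X i -> nilp X i j = 0) -> exists M, realizes M X.
Proof.
move=> up; pose A n := [pred i | n <= lv X i].
pose phi n : 'M[CC]_(#|A n|, rk X) := selmx CC (A n).
have outA n j : (j \notin A n) = (lv X j < n) by rewrite inE ltNge.
pose M := @GrMod (fun n => #|A n|) (fun n => phi n *m nilp X *m (phi (n + 1))^T)
  (fun n => phi (n + 1) *m (phi n)^T).
exists M, phi; split; first (split=> n).
- by apply/row_freeP; exists (phi n)^T; apply: selmx_tr.
- apply: selmx_proj => i j; rewrite outA => hj; apply: selmx_out; rewrite outA; lia.
- apply: selmx_proj => i j; rewrite outA => hj; rewrite mxE big1 // => k _.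
  case: (ltP (lv X k) n) => hk; first by rewrite [phi n _ _]selmx_out ?mul0r // outA.
  by rewrite up ?mulr0 //; lia.
- move=> n u; split=> [/submxP[w ->] i hi|hu].
    by rewrite mxE big1 // => k _; rewrite [phi n _ _]selmx_out ?mulr0 // outA.
  have <- : u *m (phi n)^T *m phi n = u; last exact: submxMl.
  by apply: selmx_proj => i j; rewrite outA ord1 => /hu.
Qed.

(** * Extensions as cocycles *)

Definition level_cond (X Y : fobj) (F : 'M[CC]_(rk X, rk Y)) : Prop :=
  forall i j, lv Y j < lv X i -> F i j = 0.

(* Extensions split over C[y]; [D] is then the off-diagonal block of the operator. *)
Definition ext_trivial (X Y : fobj) : Prop :=
  forall D : 'M[CC]_(rk X, rk Y),
    nilp X *m D + D *m nilp Y = 0 -> (forall i j, lv Y j <= lv X i -> D i j = 0) ->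
    exists H, @level_cond X Y H /\ D = nilp X *m H - H *m nilp Y.

Lemma realizes_up M X : realizes M X -> forall i j, lv X j <= lv X i -> nilp X i j = 0.
Proof.
move=> [phi [[f e g] b]] i j hij.
have /submxP[w hw] := delta_sub_based i b.
have /b h : (row i (nilp X) <= phi (lv X i + 1)%R)%MS.
  by rewrite rowE hw -mulmxA -g mulmxA submxMl.
by have := h j; rewrite mxE; apply; lia.
Qed.

(** [T] and [S] are filtered linear splittings; they give exactness in every degree without
    splitting the sequence of modules. *)
Lemma mx_ghom_ses M M' M'' r r' r'' (phi : forall n, 'M[CC]_(gdim M n, r))
    (phi' : forall n, 'M[CC]_(gdim M' n, r')) (phi'' : forall n, 'M[CC]_(gdim M'' n, r''))
    I T P S :
  (forall n, row_free (phi n)) -> (forall n, row_free (phi' n)) ->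
  (forall n, row_free (phi'' n)) ->
  filtered phi phi' I -> filtered phi' phi T -> filtered phi' phi'' P -> filtered phi'' phi' S ->
  I *m T = 1%:M -> S *m P = 1%:M -> I *m P = 0 -> T *m I + P *m S = 1%:M ->
  is_ses (mx_ghom phi phi' I) (mx_ghom phi' phi'' P).
Proof.
move=> f f' f'' fI fT fP fS IT SP IP TP n; split; last split.
- by apply/row_freeP; exists (mx_ghom phi' phi T n); rewrite mx_ghom_comp // IT mx_ghom1.
- by apply/row_fullP; exists (mx_ghom phi'' phi' S n); rewrite mx_ghom_comp // SP mx_ghom1.
- apply/andP; split.
    by apply/sub_kermxP; rewrite mx_ghom_comp // IP /mx_ghom mulmx0 mul0mx.
  have <- : kermx (mx_ghom phi' phi'' P n) *m mx_ghom phi' phi T n *m mx_ghom phi phi' I n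
      = kermx (mx_ghom phi' phi'' P n); last exact: submxMl.
  rewrite -mulmxA mx_ghom_comp //.
  have -> : mx_ghom phi' phi' (T *m I) n = 1%:M - mx_ghom phi' phi'' P n *m mx_ghom phi'' phi' S
    n.
    rewrite mx_ghom_comp // -(mx_ghom1 f') -TP /mx_ghom -mulmxBl -mulmxBr.
    by rewrite addrK.
  by rewrite mulmxBr mulmx1 mulmxA mulmx_ker mul0mx subr0.
Qed.

(** A cocycle D is the off-diagonal block of an operator on Y + X, and the cocycle equation says
    that this operator squares to zero. A section of the resulting extension has the form (H, 1),
    and its compatibility with the operators reads D = N_X H - H N_Y. *)
Lemma Ext1_zero_trivial A B X Y : square_zero X -> square_zero Y -> realizes A X -> realizes B Y
  ->
  Ext1_zero A B -> ext_trivial X Y.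
Proof.
move=> fX fY rA rB ext D cD lD.
pose Z := @FObj (rk Y + rk X) (block_mx (nilp Y) 0 D (nilp X)) (lv (fsum Y X)).
have lvl i : lv Z (lshift (rk X) i) = lv Y i := lv_lshift X i.
have lvr i : lv Z (rshift (rk Y) i) = lv X i := lv_rshift Y i.
have upZ : forall i j, lv Z j <= lv Z i -> nilp Z i j = 0.
  apply: fsum_ind => i; apply: fsum_ind => j; rewrite ?lvl ?lvr => h.
  - by rewrite [LHS]block_mxEul (realizes_up rB).
  - by rewrite [LHS]block_mxEur mxE.
  - by rewrite [LHS]block_mxEdl lD.
  - by rewrite [LHS]block_mxEdr (realizes_up rA).
have fZ : square_zero Z.
  have E : block_mx (nilp Y) 0 D (nilp X) *m block_mx (nilp Y) 0 D (nilp X) = 0.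
    rewrite mulmx_block fX fY addrC !mulmx0 !mul0mx !addr0 ?add0r.
    by rewrite [D *m _ + _]addrC cD block_mx0.
  exact: E.
have [E rE] := realizable upZ; have [pE [eE bE]] := rE.
have [pA [eA bA]] := rA; have [pB [eB bB]] := rB.
have [fA _ _] := eA; have [fB _ _] := eB; have [fE _ _] := eE.
pose I : 'M[CC]_(rk Y, rk Z) := row_mx 1%:M 0.
pose T : 'M[CC]_(rk Z, rk Y) := col_mx 1%:M 0.
pose P : 'M[CC]_(rk Z, rk X) := col_mx 0 1%:M.
pose S : 'M[CC]_(rk X, rk Z) := row_mx 0 1%:M.
have diag r (l : 'I_r -> int) i j : l j < l i -> (1%:M : 'M[CC]_r) i j = 0.
  by move=> h; rewrite mxE; case: eqP h => // ->; rewrite ltxx.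
have fI : filtered pB pE I.
  apply/(filtered_based _ bB eE bE) => i; apply: fsum_ind => j; rewrite ?lvl ?lvr => h.
    by rewrite [LHS]row_mxEl (diag _ (lv Y)).
  by rewrite [LHS]row_mxEr mxE.
have fT : filtered pE pB T.
  apply/(filtered_based _ bE eB bB); apply: fsum_ind => i j; rewrite ?lvl ?lvr => h.
    by rewrite [LHS]col_mxEu (diag _ (lv Y)).
  by rewrite [LHS]col_mxEd mxE.
have fP : filtered pE pA P.
  apply/(filtered_based _ bE eA bA); apply: fsum_ind => i j; rewrite ?lvl ?lvr => h.
    by rewrite [LHS]col_mxEu mxE.
  by rewrite [LHS]col_mxEd (diag _ (lv X)).
have fS : filtered pA pE S.
  apply/(filtered_based _ bA eE bE) => i; apply: fsum_ind => j; rewrite ?lvl ?lvr => h.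
    by rewrite [LHS]row_mxEl mxE.
  by rewrite [LHS]row_mxEr (diag _ (lv X)).
have cI : nilp Y *m I = I *m nilp Z.
  have e : nilp Y *m row_mx 1%:M 0 = row_mx 1%:M 0 *m block_mx (nilp Y) 0 D (nilp X).
    by rewrite mul_mx_row mul_row_block !mulmx0 !mul0mx !mul1mx mulmx1 !addr0.
  exact: e.
have cP : nilp Z *m P = P *m nilp X.
  have e : block_mx (nilp Y) 0 D (nilp X) *m col_mx 0 1%:M = col_mx 0 1%:M *m nilp X.
    by rewrite mul_block_col mul_col_mx !mulmx0 !mul0mx !mul1mx mulmx1 !add0r.
  exact: e.
have IT : I *m T = 1%:M.
  have e : row_mx 1%:M (0 : 'M_(rk Y, rk X)) *m col_mx 1%:M 0 = 1%:M :> 'M[CC]_(rk Y).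
    by rewrite mul_row_col mulmx1 mulmx0 addr0.
  exact: e.
have SP : S *m P = 1%:M.
  have e : row_mx (0 : 'M_(rk X, rk Y)) 1%:M *m col_mx 0 1%:M = 1%:M :> 'M[CC]_(rk X).
    by rewrite mul_row_col mulmx1 mulmx0 add0r.
  exact: e.
have IP : I *m P = 0.
  have e : row_mx 1%:M 0 *m col_mx 0 1%:M = 0 :> 'M[CC]_(rk Y, rk X).
    by rewrite mul_row_col mulmx0 mul0mx addr0.
  exact: e.
have TP : T *m I + P *m S = 1%:M.
  have e : col_mx 1%:M 0 *m row_mx 1%:M 0 + col_mx 0 1%:M *m row_mx 0 1%:M
      = 1%:M :> 'M[CC]_(rk Y + rk X).
    by rewrite !mul_col_row !mul1mx !mul0mx add_block_mx !addr0 !add0r -scalar_mx_block.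
  exact: e.
have [s [hs sp]] := ext E _ _ (realizes_in_C2 fZ rE) (mx_ghomP eB eE fI cI)
  (mx_ghomP eE eA fP cP) (mx_ghom_ses fB fE fA fI fT fP fS IT SP IP TP).
have exA := based_exhausting bA.
have [G [cG [fG sG]]] := ghom_mx eA exA eE hs.
have GP : G *m P = 1%:M.
  have [n0 full] := exA; apply: (row_full_cancel (full n0 (lexx _))).
  have := mx_ghomE fP n0; move: (mx_ghom pE pA P n0) (sp n0) => p sp0 ep.
  by rewrite mulmxA -sG -mulmxA -ep mulmxA sp0 mul1mx mulmx1.
have [H eG] : exists H : 'M_(rk X, rk Y), G = row_mx H 1%:M.
  exists (lsubmx G); rewrite -[LHS]hsubmxK; congr row_mx.
  by rewrite -GP /P -[X in X *m _]hsubmxK mul_row_col mulmx0 mulmx1 add0r.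
have e : nilp X *m row_mx H 1%:M = row_mx H 1%:M *m block_mx (nilp Y) 0 D (nilp X).
  by have := cG; rewrite eG.
move: e; rewrite mul_mx_row mul_row_block => /eq_row_mx[e _].
exists H; split; last by rewrite e mul1mx addrAC subrr add0r.
move=> i j hij; have := (filtered_based _ bA eE bE).1 fG i (lshift _ j).
by rewrite lvl eG => /(_ hij) <-; rewrite [RHS]row_mxEl.
Qed.

Lemma trivial_Ext1_zero A B X Y : square_zero X -> square_zero Y -> realizes A X -> realizes B Y
  ->
  ext_trivial X Y -> Ext1_zero A B.
Proof.
move=> fX fY rA rB ext E i p cE hi hp ses.
have [t [vt [pE [eE bE]]]] := decompose cE.
have [pA [eA bA]] := rA; have [pB [eB bB]] := rB.
have [fA gA xA] := eA; have [fB gB xB] := eB; have [fE gE xE] := eE.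
set Z := fobj_of t in pE eE bE fE gE xE; have N0 : nilp Z *m nilp Z = 0 := square_zero_tree t.
have exA := based_exhausting bA; have exB := based_exhausting bB.
have [I [cI [fI iI]]] := ghom_mx eB exB eE hi.
have [P [cP [fP pP]]] := ghom_mx eE (based_exhausting bE) eA hp.
have ip n : i n *m p n = 0.
  by have [_ [_ /andP[/sub_kermxP]]] := ses n.
have IP : I *m P = 0.
  have [n0 full] := exB; apply: (row_full_cancel (full n0 (lexx _))).
  by rewrite mulmxA -iI -mulmxA -pP mulmxA ip mul0mx mulmx0.
have Ifree : row_free I.
  have [n0 full] := exB; have [h _] := ses n0.
  have h1 : row_free (pB n0 *m I) by rewrite -iI row_free_mul.
  have [B' hB'] := row_fullP (full n0 (lexx _)).
  apply: row_freeI => u hu; have e : u *m B' *m (pB n0 *m I) = 0.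
    by rewrite mulmxA -(mulmxA u) hB' mulmx1.
  have e2 : u *m B' = 0 by apply: (row_free_inj h1); rewrite mul0mx.
  by rewrite -[u]mulmx1 -hB' mulmxA e2 mul0mx.
(* Each basis vector is lifted within its own level, as p is onto in every degree. The defect [C] of
   this linear section, pulled back along [I], is the cocycle of the extension. *)
have [S0 [fS0 S0P]] : exists S0 : 'M_(rk X, rk Z),
    (forall k, (row k S0 <= pE (lv X k))%MS) /\ S0 *m P = 1%:M.
  have hz k : exists z : 'rV_(rk Z), (z <= pE (lv X k))%MS /\ z *m P = delta_mx 0 k.
    have /submxP[u hu] := delta_sub_based k bA.
    have [_ [/row_fullP[B' hB'] _]] := ses (lv X k).
    exists (u *m B' *m pE (lv X k)); split; first exact: submxMl.
    by rewrite -mulmxA -pP mulmxA -(mulmxA u) hB' mulmx1.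
  have [z {}hz] := fin_all_exists hz.
  exists (\matrix_k z k); split=> [k|]; first by rewrite rowK; case: (hz k).
  by apply/row_matrixP => k; rewrite row_mul rowK row1; case: (hz k).
pose C := nilp X *m S0 - S0 *m nilp Z.
have CP : C *m P = 0.
  by rewrite mulmxBl -!mulmxA cP S0P mulmx1 mulmxA S0P mul1mx subrr.
have CE : nilp X *m C + C *m nilp Z = 0.
  rewrite /C mulmxBr mulmxBl !mulmxA -(mulmxA S0) N0 mulmx0 subr0.
  by rewrite fX mul0mx sub0r addNr.
(* Both operators raise levels strictly, so row k of [C] lies one step beyond the level of k. This
   gives [D] the strict level condition. *)
have CR k : exists d : 'rV_(rk Y), d *m I = row k C /\ (d <= pB (lv X k + 1)%R)%MS.
  have h1 : (row k (nilp X *m S0) <= pE (lv X k + 1)%R)%MS.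
    rewrite row_mul mulmx_sum_row; apply: summx_sub => j _.
    case: (leP (lv X j) (lv X k)) => hj.
      by rewrite mxE (realizes_up rA hj) scale0r sub0mx.
    apply: scalemx_sub; apply: submx_trans (fS0 j) _.
    by apply: (emb_mono eE); lia.
  have h2 : (row k (S0 *m nilp Z) <= pE (lv X k + 1)%R)%MS.
    have /submxP[w hw] := fS0 k.
    by rewrite row_mul hw -mulmxA -xE mulmxA submxMl.
  have /submxP[w hw] : (row k C <= pE (lv X k + 1)%R)%MS.
    by rewrite /C linearB /= addmx_sub // eqmx_opp.
  have wp : w *m p (lv X k + 1) = 0.
    apply: (row_free_inj (fA _)).
    by rewrite mul0mx -mulmxA pP mulmxA -hw -row_mul CP row0.
  have [_ [_ /andP[_ hk]]] := ses (lv X k + 1).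
  have /submxP[w' hw'] : (w <= i (lv X k + 1)%R)%MS.
    by apply: submx_trans hk; apply/sub_kermxP.
  exists (w' *m pB (lv X k + 1)); split; last exact: submxMl.
  by rewrite hw hw' -mulmxA -iI mulmxA.
have [d hd] := fin_all_exists CR.
pose D : 'M_(rk X, rk Y) := \matrix_k d k.
have DI : D *m I = C.
  by apply/row_matrixP => k; rewrite row_mul rowK; case: (hd k).
have lD a b : lv Y b <= lv X a -> D a b = 0.
  by move=> hab; rewrite mxE; case: (hd a) => _ /bB; apply; lia.
have cD : nilp X *m D + D *m nilp Y = 0.
  apply: (row_free_inj Ifree); rewrite mul0mx mulmxDl -mulmxA DI.
  by rewrite -mulmxA cI mulmxA DI.
have [H [lH eH]] := ext D cD lD.
pose S := S0 - H *m I.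
have fS : filtered pA pE S.
  apply/(filtered_rows _ bA eE) => k.
  have hHk : (row k H <= pB (lv X k))%MS.
    by apply/bB => j hj; rewrite mxE lH.
  have h : (row k (H *m I) <= pE (lv X k))%MS.
    by rewrite row_mul; apply: submx_trans (fI (lv X k)); apply: submxMr.
  by rewrite /S linearB /= addmx_sub // eqmx_opp.
have cS : nilp X *m S = S *m nilp Z.
  have e1 : nilp X *m S0 = C + S0 *m nilp Z by rewrite /C subrK.
  have e2 : C = nilp X *m H *m I - H *m nilp Y *m I by rewrite -DI eH mulmxBl.
  rewrite /S mulmxBr mulmxBl -[H *m I *m _]mulmxA -cI !mulmxA e1 e2.
  by rewrite addrC !addrA addNr sub0r addrC.
have SP : S *m P = 1%:M by rewrite mulmxBl S0P -mulmxA IP mulmx0 subr0.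
exists (mx_ghom pA pE S); split; first exact: mx_ghomP eA eE fS cS.
move=> n; apply: (row_free_inj (fA n)).
have := mx_ghomE fS n; move: (mx_ghom pA pE S n) => s es.
by rewrite -mulmxA pP mulmxA es -mulmxA SP mulmx1 mul1mx.
Qed.

Lemma ext_trivial_suml X X' Y :
  ext_trivial (fsum X X') Y <-> ext_trivial X Y /\ ext_trivial X' Y.
Proof.
have mulE (D1 : 'M_(rk X, rk Y)) (D2 : 'M_(rk X', rk Y)) :
    nilp (fsum X X') *m col_mx D1 D2 = col_mx (nilp X *m D1) (nilp X' *m D2).
  have E : block_mx (nilp X) 0 0 (nilp X') *m col_mx D1 D2
      = col_mx (nilp X *m D1) (nilp X' *m D2).
    by rewrite mul_block_col !mul0mx addr0 add0r.
  exact: E.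
have subE (D1 E1 : 'M[CC]_(rk X, rk Y)) (D2 E2 : 'M_(rk X', rk Y)) :
    col_mx D1 D2 - col_mx E1 E2 = col_mx (D1 - E1) (D2 - E2).
  by rewrite opp_col_mx add_col_mx.
split=> [h|[h1 h2] D cD lD].
  split=> D cD lD.
    have [||H [lH eH]] := h (col_mx D 0).
    - by rewrite mulE mul_col_mx add_col_mx cD mulmx0 mul0mx addr0 col_mx0.
    - apply: fsum_ind => i j; rewrite (lv_lshift, lv_rshift) => hij.
        by rewrite [LHS]col_mxEu lD.
      by rewrite [LHS]col_mxEd mxE.
    exists (usubmx H); split.
      by move=> i j hij; rewrite mxE lH // lv_lshift.
    by move: eH; rewrite -[H]vsubmxK mulE mul_col_mx subE col_mxKu => /eq_col_mx[].
  have [||H [lH eH]] := h (col_mx 0 D).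
  - by rewrite mulE mul_col_mx add_col_mx cD mulmx0 mul0mx addr0 col_mx0.
  - apply: fsum_ind => i j; rewrite (lv_lshift, lv_rshift) => hij.
      by rewrite [LHS]col_mxEu mxE.
    by rewrite [LHS]col_mxEd lD.
  exists (dsubmx H); split.
    by move=> i j hij; rewrite mxE lH // lv_rshift.
  by move: eH; rewrite -[H]vsubmxK mulE mul_col_mx subE col_mxKd => /eq_col_mx[].
move: cD lD; rewrite -[D]vsubmxK; move: (usubmx D) (dsubmx D) => D1 D2.
rewrite mulE mul_col_mx add_col_mx -[0]col_mx0 => /eq_col_mx[c1 c2] lD.
have [||H1 [l1 e1]] := h1 D1 => //.
  by move=> i j hij; have := lD (lshift _ i) j; rewrite lv_lshift [LHS]col_mxEu; apply.
have [||H2 [l2 e2]] := h2 D2 => //.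
  by move=> i j hij; have := lD (rshift _ i) j; rewrite lv_rshift [LHS]col_mxEd; apply.
exists (col_mx H1 H2); split; last by rewrite mulE mul_col_mx subE -e1 -e2.
apply: fsum_ind => i j; rewrite (lv_lshift, lv_rshift) => hij.
  by rewrite [LHS]col_mxEu l1.
by rewrite [LHS]col_mxEd l2.
Qed.

Lemma ext_trivial_sumr X Y Y' :
  ext_trivial X (fsum Y Y') <-> ext_trivial X Y /\ ext_trivial X Y'.
Proof.
have mulE (D1 : 'M_(rk X, rk Y)) (D2 : 'M_(rk X, rk Y')) :
    row_mx D1 D2 *m nilp (fsum Y Y') = row_mx (D1 *m nilp Y) (D2 *m nilp Y').
  have E : row_mx D1 D2 *m block_mx (nilp Y) 0 0 (nilp Y')
      = row_mx (D1 *m nilp Y) (D2 *m nilp Y').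
    by rewrite mul_row_block !mulmx0 addr0 add0r.
  exact: E.
have subE (D1 E1 : 'M[CC]_(rk X, rk Y)) (D2 E2 : 'M_(rk X, rk Y')) :
    row_mx D1 D2 - row_mx E1 E2 = row_mx (D1 - E1) (D2 - E2).
  by rewrite opp_row_mx add_row_mx.
split=> [h|[h1 h2] D cD lD].
  split=> D cD lD.
    have [||H [lH eH]] := h (row_mx D 0).
    - by rewrite mulE mul_mx_row add_row_mx cD mulmx0 mul0mx addr0 row_mx0.
    - move=> i; apply: fsum_ind => j; rewrite (lv_lshift, lv_rshift) => hij.
        by rewrite [LHS]row_mxEl lD.
      by rewrite [LHS]row_mxEr mxE.
    exists (lsubmx H); split.
      by move=> i j hij; rewrite mxE lH // lv_lshift.
    by move: eH; rewrite -[H]hsubmxK mulE mul_mx_row subE row_mxKl => /eq_row_mx[].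
  have [||H [lH eH]] := h (row_mx 0 D).
  - by rewrite mulE mul_mx_row add_row_mx cD mulmx0 mul0mx addr0 row_mx0.
  - move=> i; apply: fsum_ind => j; rewrite (lv_lshift, lv_rshift) => hij.
      by rewrite [LHS]row_mxEl mxE.
    by rewrite [LHS]row_mxEr lD.
  exists (rsubmx H); split.
    by move=> i j hij; rewrite mxE lH // lv_rshift.
  by move: eH; rewrite -[H]hsubmxK mulE mul_mx_row subE row_mxKr => /eq_row_mx[].
move: cD lD; rewrite -[D]hsubmxK; move: (lsubmx D) (rsubmx D) => D1 D2.
rewrite mulE mul_mx_row add_row_mx -[0]row_mx0 => /eq_row_mx[c1 c2] lD.
have [||H1 [l1 e1]] := h1 D1 => //.
  by move=> i j hij; have := lD i (lshift _ j); rewrite lv_lshift [LHS]row_mxEl; apply.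
have [||H2 [l2 e2]] := h2 D2 => //.
  by move=> i j hij; have := lD i (rshift _ j); rewrite lv_rshift [LHS]row_mxEr; apply.
exists (row_mx H1 H2); split; last by rewrite mulE mul_mx_row subE -e1 -e2.
move=> i; apply: fsum_ind => j; rewrite (lv_lshift, lv_rshift) => hij.
  by rewrite [LHS]row_mxEl l1.
by rewrite [LHS]row_mxEr l2.
Qed.

Lemma ext_trivial_tree t u : ext_trivial (fobj_of t) (fobj_of u) <->
  leaves (fun al => leaves (fun be => ext_trivial (arc_obj al) (arc_obj be)) u) t.
Proof.
elim: t => [|al|t1 IH1 t2 IH2]; last by rewrite ext_trivial_suml IH1 IH2.
  split=> // _ D _ _; exists 0; split; first by move=> i j _; rewrite mxE.
  by apply/matrixP => -[].
elim: u => [|be|u1 IH1 u2 IH2] //; last by rewrite ext_trivial_sumr IH1 IH2.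
split=> // _ D _ _; exists 0; split; first by move=> i j _; rewrite mxE.
by apply/matrixP => ? -[].
Qed.

(** * Ext between two arcs *)

Lemma ord2P (i : 'I_2) : i = 0 \/ i = 1.
Proof. by case: i => [[|[|//]]] h; [left | right]; apply: val_inj. Qed.

Lemma ord2E : (lshift 1 (0 : 'I_1) = 0 :> 'I_2) * (rshift 1 (0 : 'I_1) = 1 :> 'I_2).
Proof. by split; apply: val_inj. Qed.

Lemma nil2_mul n (A : 'M_(1 + 1, n)) (j : 'I_n) :
  (nil2 *m A) (0 : 'I_2) j = 0 /\ (nil2 *m A) (1 : 'I_2) j = A (0 : 'I_2) j.
Proof.
rewrite -!ord2E; rewrite -[A]vsubmxK /nil2 mul_block_col !mul0mx mul1mx !addr0.
by split; rewrite ?col_mxEd !col_mxEu // mxE.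
Qed.

Lemma mul_nil2 n (A : 'M_(n, 1 + 1)) (i : 'I_n) :
  (A *m nil2) i (0 : 'I_2) = A i (1 : 'I_2) /\ (A *m nil2) i (1 : 'I_2) = 0.
Proof.
rewrite -!ord2E; rewrite -[A]hsubmxK /nil2 mul_row_block !mulmx0 mulmx1 !add0r.
by split; rewrite ?row_mxEl !row_mxEr // mxE.
Qed.

Definition mx22 (a b c d : CC) : 'M[CC]_(1 + 1) :=
  \matrix_(i, j) if i == 0 :> 'I_2 then (if j == 0 :> 'I_2 then a else b)
                 else (if j == 0 :> 'I_2 then c else d).

Lemma mx22E a b c d :
  [/\ mx22 a b c d (0 : 'I_2) (0 : 'I_2) = a, mx22 a b c d (0 : 'I_2) (1 : 'I_2) = b,
      mx22 a b c d (1 : 'I_2) (0 : 'I_2) = c & mx22 a b c d (1 : 'I_2) (1 : 'I_2) = d].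
Proof. by rewrite !mxE. Qed.

Lemma eq_mx22 (A B : 'M[CC]_(1 + 1)) :
  A (0 : 'I_2) (0 : 'I_2) = B (0 : 'I_2) (0 : 'I_2) -> A (0 : 'I_2) (1 : 'I_2) = B (0 : 'I_2) (1
    : 'I_2) ->
  A (1 : 'I_2) (0 : 'I_2) = B (1 : 'I_2) (0 : 'I_2) -> A (1 : 'I_2) (1 : 'I_2) = B (1 : 'I_2) (1
    : 'I_2) -> A = B.
Proof.
move=> h1 h2 h3 h4; apply/matrixP => i j.
by case: (ord2P i) => ->; case: (ord2P j) => ->.
Qed.

Lemma anticomm_nil2 (D : 'M[CC]_(1 + 1)) : nil2 *m D + D *m nil2 =
  mx22 (D (0 : 'I_2) (1 : 'I_2)) 0 (D (0 : 'I_2) (0 : 'I_2) + D (1 : 'I_2) (1 : 'I_2))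
    (D (0 : 'I_2) (1 : 'I_2)).
Proof.
have [a b c d] := mx22E (D (0 : 'I_2) (1 : 'I_2)) 0
  (D (0 : 'I_2) (0 : 'I_2) + D (1 : 'I_2) (1 : 'I_2)) (D (0 : 'I_2) (1 : 'I_2)).
have [n0 n1] := (fun j => (nil2_mul D j).1, fun j => (nil2_mul D j).2).
have [m0 m1] := (fun i => (mul_nil2 D i).1, fun i => (mul_nil2 D i).2).
by apply: eq_mx22; rewrite ?a ?b ?c ?d mxE; [rewrite n0 m0 | rewrite n0 m1 |
  rewrite n1 m0 | rewrite n1 m1]; rewrite ?addr0 ?add0r.
Qed.

Lemma comm_nil2 (H : 'M[CC]_(1 + 1)) : nil2 *m H - H *m nil2 =
  mx22 (- H (0 : 'I_2) (1 : 'I_2)) 0 (H (0 : 'I_2) (0 : 'I_2) - H (1 : 'I_2) (1 : 'I_2))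
    (H (0 : 'I_2) (1 : 'I_2)).
Proof.
have [a b c d] := mx22E (- H (0 : 'I_2) (1 : 'I_2)) 0
  (H (0 : 'I_2) (0 : 'I_2) - H (1 : 'I_2) (1 : 'I_2)) (H (0 : 'I_2) (1 : 'I_2)).
have [n0 n1] := (fun j => (nil2_mul H j).1, fun j => (nil2_mul H j).2).
have [m0 m1] := (fun i => (mul_nil2 H i).1, fun i => (mul_nil2 H i).2).
by apply: eq_mx22; rewrite ?a ?b ?c ?d [LHS]mxE [X in _ + X = _]mxE; [rewrite n0 m0 | rewrite n0
  m1 |
  rewrite n1 m0 | rewrite n1 m1]; rewrite ?subr0 ?sub0r ?oppr0.
Qed.

(* Limit arcs never cross, but they extend each other in one direction. *)
Definition ext_arcs (al be : Defs.arc) : Prop :=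
  crossing al be \/ (al.1 = None /\ be.1 = None /\ al.2 < be.2).

(** Index 0 is vN and index 1 is v. A cocycle has two free entries: D11 = -D00, possible if a < c
    and b < d, and D10, possible if a < d. The first is a coboundary through H01, allowed if b <= c;
    the second through H00 - H11, allowed if b <= d or a <= c respectively. Each of the two ways of
    crossing blocks one of them. *)
Lemma ext_trivial_finfin a b c d : ext_trivial (arc_obj (Some a, b)) (arc_obj (Some c, d)) <->
  ~ ((a < c /\ c < b /\ b < d) \/ (c < a /\ a < d /\ d < b)).
Proof.
rewrite /ext_trivial !arc_obj_nil2; split=> [h|h D].
  case=> [[ac [cb bd]]|[ca [ad db]]].
    have [a0 a1 a2 a3] := mx22E (-1) 0 0 1.
    have [||H [lH e]] := h (mx22 (-1) 0 0 1).
    - apply: (etrans (anticomm_nil2 _)); rewrite a0 a1 a3 addNr.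
      by apply: eq_mx22; rewrite !mxE.
    - move=> i j; case: (ord2P i) => ->; case: (ord2P j) => ->; rewrite ?a0 ?a1 ?a2 ?a3 //= => hh.
        by exfalso; move: hh; lia.
      by exfalso; move: hh; lia.
    have := congr1 (fun A : 'M_2 => A 1 1) (etrans e (comm_nil2 _)).
    rewrite a3 (let: And4 _ _ _ x := mx22E _ _ _ _ in x) lH //.
    by move/eqP; rewrite oner_eq0.
  have [a0 a1 a2 a3] := mx22E 0 0 1 0.
  have [||H [lH e]] := h (mx22 0 0 1 0).
  - apply: (etrans (anticomm_nil2 _)); rewrite a0 a1 a3 addr0.
    by apply: eq_mx22; rewrite !mxE.
  - move=> i j; case: (ord2P i) => ->; case: (ord2P j) => ->; rewrite ?a0 ?a1 ?a2 ?a3 //= => hh.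
    by exfalso; move: hh; lia.
  have := congr1 (fun A : 'M_2 => A 1 0) (etrans e (comm_nil2 _)).
  rewrite a2 (let: And4 _ _ x _ := mx22E _ _ _ _ in x) !lH ?subr0 //.
  by move/eqP; rewrite oner_eq0.
move/(etrans (esym (anticomm_nil2 _))) => e lD.
have e0 : D 0 1 = 0.
  by have := congr1 (fun A : 'M_2 => A 0 0) e; rewrite [LHS]mxE [RHS]mxE.
have e1 : D 0 0 + D 1 1 = 0.
  by have := congr1 (fun A : 'M_2 => A 1 0) e; rewrite [LHS]mxE [RHS]mxE.
have l1 : D 1 1 = 0 \/ a < c /\ b < d.
  case: (boolP ((a < c) && (b < d))) => [/andP|]; first by right.
  rewrite negb_and -!leNgt => /orP[hh|hh]; first by left; apply: lD.
  by left; move: e1; rewrite (lD 0 0) // add0r.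
have l2 : D 1 0 = 0 \/ a < d.
  by case: (ltP a d) => hh; [right | left; apply: lD].
clear lD.
have [x [y [xy [hx hy]]]] : exists x y : CC, D 1 0 = x - y /\ (x = 0 \/ b <= d) /\ (y = 0 \/ a
  <= c).
  case: l2 => l2; first by exists 0, 0; rewrite l2 subr0; auto.
  case: (leP b d) => hh; first by exists (D 1 0), 0; rewrite subr0; auto.
  exists 0, (- D 1 0); rewrite sub0r opprK; split=> //; split; auto.
  by right; rewrite leNgt; apply/negP => ca; apply: h; right.
exists (mx22 x (D 1 1) 0 y); have [a0 a1 a2 a3] := mx22E x (D 1 1) 0 y; split.
  move=> i j; case: (ord2P i) => ->; case: (ord2P j) => ->; rewrite ?a0 ?a1 ?a2 ?a3 //= => hh.
  - by case: hx => // hx; move: hh; lia.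
  - case: l1 => // -[ac bd]; exfalso; apply: h; left; split=> //; split=> //.
  - by case: hy => // hy; move: hh; lia.
apply: esym; apply: (etrans (comm_nil2 _)); rewrite a0 a1 a3.
have [b0 b1 b2 b3] := mx22E (- D 1 1) 0 (x - y) (D 1 1).
apply: eq_mx22; rewrite ?b0 ?b1 ?b2 ?b3 //.
by apply/eqP; rewrite eq_sym -addr_eq0 e1.
Qed.

Lemma ext_trivial_limfin b c d : ext_trivial (arc_obj (None, b)) (arc_obj (Some c, d)) <->
  ~ (c < b /\ b < d).
Proof.
rewrite /ext_trivial !arc_obj_nil2; split=> [h [cb bd]|h D].
  pose D : 'M[CC]_(1, 1 + 1) := \row_j (j == 0 :> 'I_2)%:R.
  have D0 : D 0 (0 : 'I_2) = 1 by rewrite mxE.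
  have D1 : D 0 (1 : 'I_2) = 0 by rewrite mxE.
  have [||H [lH e]] := h D.
  - rewrite mul0mx add0r; apply/matrixP => i j; rewrite ord1 [RHS]mxE.
    case: (ord2P j) => ->; last exact: (mul_nil2 D 0).2.
    by apply: (etrans (mul_nil2 D 0).1).
  - move=> i j; rewrite (ord1 i); case: (ord2P j) => -> //= hh.
    by exfalso; move: hh; lia.
  have := congr1 (fun A : 'M_(1, 2) => A 0 0) e.
  rewrite mul0mx sub0r D0 [RHS]mxE (mul_nil2 H 0).1 lH // oppr0.
  by move/eqP; rewrite oner_eq0.
rewrite mul0mx add0r => e lD.
have D1 : D 0 1 = 0.
  have := congr1 (fun A : 'M_(1, 2) => A 0 0) e.
  by rewrite [RHS]mxE; apply: etrans; rewrite (mul_nil2 D 0).1.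
have [D0|[bc bd]] : D 0 0 = 0 \/ (b <= c /\ b < d).
- case: (leP d b) => db; first by left; apply: lD.
  by right; split=> //; rewrite leNgt; apply/negP => cb; apply: h.
- exists 0; split=> [i j _|]; first by rewrite mxE.
  rewrite mulmx0 mul0mx subr0; apply/matrixP => i j; rewrite ord1 [RHS]mxE.
  by case: (ord2P j) => ->.
pose H : 'M[CC]_(1, 1 + 1) := \row_j (if j == 0 :> 'I_2 then 0 else - D 0 0).
have H0 : H 0 (0 : 'I_2) = 0 by rewrite mxE.
have H1 : H 0 (1 : 'I_2) = - D 0 0 by rewrite mxE.
exists H; split.
  move=> i j; rewrite (ord1 i); case: (ord2P j) => -> //= hh.
  by exfalso; move: hh; lia.
rewrite mul0mx sub0r; apply/matrixP => i j; rewrite ord1 [RHS]mxE.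
case: (ord2P j) => ->; first by rewrite (mul_nil2 H 0).1 H1 opprK.
by rewrite (mul_nil2 H 0).2 oppr0.
Qed.

Lemma ext_trivial_finlim a b d : ext_trivial (arc_obj (Some a, b)) (arc_obj (None, d)) <->
  ~ (a < d /\ d < b).
Proof.
rewrite /ext_trivial !arc_obj_nil2; split=> [h [ad db]|h D].
  pose D : 'M[CC]_(1 + 1, 1) := \col_j (j == 1 :> 'I_2)%:R.
  have D0 : D (0 : 'I_2) 0 = 0 by rewrite mxE.
  have D1 : D (1 : 'I_2) 0 = 1 by rewrite mxE.
  have [||H [lH e]] := h D.
  - rewrite mulmx0 addr0; apply/matrixP => i j; rewrite ord1 [RHS]mxE.
    case: (ord2P i) => ->; first exact: (nil2_mul D 0).1.
    by apply: (etrans (nil2_mul D 0).2).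
  - move=> i j; rewrite (ord1 j); case: (ord2P i) => -> //= hh.
    by exfalso; move: hh; lia.
  have := congr1 (fun A : 'M_(2, 1) => A 1 0) e.
  rewrite mulmx0 subr0 D1 (nil2_mul H 0).2 lH //.
  by move/eqP; rewrite oner_eq0.
rewrite mulmx0 addr0 => e lD.
have D0 : D 0 0 = 0.
  have := congr1 (fun A : 'M_(2, 1) => A 1 0) e.
  by rewrite [RHS]mxE; apply: etrans; rewrite (nil2_mul D 0).2.
have [D1|[ad bd]] : D 1 0 = 0 \/ (a < d /\ b <= d).
- case: (leP d a) => da; first by left; apply: lD.
  by right; split=> //; rewrite leNgt; apply/negP => db; apply: h.
- exists 0; split=> [i j _|]; first by rewrite mxE.
  rewrite mulmx0 mul0mx subr0; apply/matrixP => i j; rewrite ord1 [RHS]mxE.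
  by case: (ord2P i) => ->.
pose H : 'M[CC]_(1 + 1, 1) := \col_j (if j == 0 :> 'I_2 then D 1 0 else 0).
have H0 : H (0 : 'I_2) 0 = D 1 0 by rewrite mxE.
have H1 : H (1 : 'I_2) 0 = 0 by rewrite mxE.
exists H; split.
  move=> i j; rewrite (ord1 j); case: (ord2P i) => -> //= hh.
  by exfalso; move: hh; lia.
rewrite mulmx0 subr0; apply/matrixP => i j; rewrite ord1.
by case: (ord2P i) => ->; rewrite ?(nil2_mul H 0).1 ?(nil2_mul H 0).2.
Qed.

(** Both operators vanish, so every D is a cocycle and only 0 is a coboundary. A nonzero D has to
    raise the level strictly, whence the asymmetry. *)
Lemma ext_trivial_limlim b d : ext_trivial (arc_obj (None, b)) (arc_obj (None, d)) <-> ~ (b < d).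
Proof.
have E1 (D : 'M[CC]_1) : (0 : 'M_1) *m D + D *m (0 : 'M_1) = 0.
  by rewrite mul0mx mulmx0 addr0.
have E2 (H : 'M[CC]_1) : (0 : 'M_1) *m H - H *m (0 : 'M_1) = 0.
  by rewrite mul0mx mulmx0 subr0.
split=> [h bd|h D _ lD].
  have [||H [lH e]] := h (const_mx 1).
  - exact: E1.
  - by move=> i j /= hh; exfalso; move: hh; lia.
  have := congr1 (fun A : 'M_(1, 1) => A 0 0) (etrans e (E2 H)).
  by rewrite !mxE => /eqP; rewrite oner_eq0.
exists 0; split=> [i j _|]; first by rewrite mxE.
apply: etrans (esym (E2 0)); apply/matrixP => i j; rewrite lD ?mxE //.
by rewrite leNgt; apply/negP.
Qed.

Lemma ext_trivial_arcs al be : ext_trivial (arc_obj al) (arc_obj be) <-> ~ ext_arcs al be.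
Proof.
case: al be => [[a|] b] [[c|] d]; rewrite /ext_arcs /crossing /=.
- rewrite ext_trivial_finfin; split=> h h'; apply: h.
    by case: h' => // -[].
  by left.
- rewrite ext_trivial_finlim; split=> h h'; apply: h.
    by case: h' => [[[]|[_]]|[]].
  by left; right.
- rewrite ext_trivial_limfin; split=> h h'; apply: h.
    by case: h' => [[[_]|[]]|[_ []]].
  by left; left.
- rewrite ext_trivial_limlim; split=> h h'; apply: h.
    by case: h' => [[[]|[]]|[_ []]].
  by right.
Qed.

(** * Morphisms between arcs *)

Lemma fhom_comp X Y Z F G : @is_fhom X Y F -> @is_fhom Y Z G -> @is_fhom X Z (F *m G).
Proof.
move=> [c l] [c' l']; split; first by rewrite mulmxA c -mulmxA c' mulmxA.
move=> i j hij; rewrite mxE big1 // => k _.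
case: (ltP (lv Y k) (lv X i)) => hk; first by rewrite l ?mul0r.
by rewrite l' ?mulr0 //; apply: lt_le_trans hij hk.
Qed.

Lemma fhom_scale X Y (x : CC) F : @is_fhom X Y F -> @is_fhom X Y (x *: F).
Proof.
move=> [c l]; split; first by rewrite -scalemxAl -scalemxAr c.
by move=> i j hij; rewrite mxE l ?mulr0.
Qed.

Lemma fhom_zero X Y : @is_fhom X Y 0.
Proof. by split=> [|i j _]; rewrite ?mulmx0 ?mul0mx ?mxE. Qed.

Lemma fhom_sumr X Y Y' F F' : @is_fhom X (fsum Y Y') (row_mx F F') <-> @is_fhom X Y F /\
  @is_fhom X Y' F'.
Proof.
have E : (nilp X *m row_mx F F' = row_mx F F' *m nilp (fsum Y Y')) <->
    (nilp X *m F = F *m nilp Y) /\ (nilp X *m F' = F' *m nilp Y').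
  have -> : row_mx F F' *m nilp (fsum Y Y') = row_mx (F *m nilp Y) (F' *m nilp Y').
    have E : row_mx F F' *m block_mx (nilp Y) 0 0 (nilp Y')
        = row_mx (F *m nilp Y) (F' *m nilp Y').
      by rewrite mul_row_block !mulmx0 addr0 add0r.
    exact: E.
  by rewrite mul_mx_row; split=> [/eq_row_mx|[-> ->]].
rewrite /is_fhom E; split=> [[[c1 c2] l]|[[c1 l1] [c2 l2]]].
  split; split=> // i j hij.
    by have := l i (lshift _ j); rewrite lv_lshift [LHS]row_mxEl; apply.
  by have := l i (rshift _ j); rewrite lv_rshift [LHS]row_mxEr; apply.
split=> // i; apply: fsum_ind => j; rewrite (lv_lshift, lv_rshift) => hij.
  by rewrite [LHS]row_mxEl l1.
by rewrite [LHS]row_mxEr l2.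
Qed.

Lemma fhom_suml X X' Y F F' : @is_fhom (fsum X X') Y (col_mx F F') <-> @is_fhom X Y F /\
  @is_fhom X' Y F'.
Proof.
have E : (nilp (fsum X X') *m col_mx F F' = col_mx F F' *m nilp Y) <->
    (nilp X *m F = F *m nilp Y) /\ (nilp X' *m F' = F' *m nilp Y).
  have -> : nilp (fsum X X') *m col_mx F F' = col_mx (nilp X *m F) (nilp X' *m F').
    have E : block_mx (nilp X) 0 0 (nilp X') *m col_mx F F'
        = col_mx (nilp X *m F) (nilp X' *m F').
      by rewrite mul_block_col !mul0mx addr0 add0r.
    exact: E.
  by rewrite mul_col_mx; split=> [/eq_col_mx|[-> ->]].
rewrite /is_fhom E; split=> [[[c1 c2] l]|[[c1 l1] [c2 l2]]].
  split; split=> // i j hij.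
    by have := l (lshift _ i) j; rewrite lv_lshift [LHS]col_mxEu; apply.
  by have := l (rshift _ i) j; rewrite lv_rshift [LHS]col_mxEd; apply.
split=> //; apply: fsum_ind => i j; rewrite (lv_lshift, lv_rshift) => hij.
  by rewrite [LHS]col_mxEu l1.
by rewrite [LHS]col_mxEd l2.
Qed.

(* [eps : (a, b) -> (-oo, d)] maps [v] to the generator, and [kap : (-oo, b) -> (c, d)] maps
   the generator to [v N]; so [eps *m kap] is the second basic map between finite arcs. *)
Definition eps : 'M[CC]_(1 + 1, 1) := col_mx 0 1%:M.
Definition kap : 'M[CC]_(1, 1 + 1) := row_mx 1%:M 0.

Lemma eps_kap : eps *m kap = nil2.
Proof. by rewrite /eps /kap mul_col_row !mul0mx !mul1mx. Qed.

Lemma epsE : eps (0 : 'I_2) 0 = 0 /\ eps (1 : 'I_2) 0 = 1.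
Proof. by rewrite -!ord2E col_mxEu col_mxEd !mxE. Qed.

Lemma kapE : kap 0 (0 : 'I_2) = 1 /\ kap 0 (1 : 'I_2) = 0.
Proof. by rewrite -!ord2E row_mxEl row_mxEr !mxE. Qed.

Lemma nil2E : [/\ nil2 (0 : 'I_2) (0 : 'I_2) = 0, nil2 (0 : 'I_2) (1 : 'I_2) = 0,
  nil2 (1 : 'I_2) (0 : 'I_2) = 1 & nil2 (1 : 'I_2) (1 : 'I_2) = 0].
Proof.
by rewrite -!ord2E /nil2 block_mxEul block_mxEur block_mxEdl block_mxEdr !mxE.
Qed.

Lemma fhom_id a b c d : a <= c -> b <= d -> @is_fhom (arc_obj (Some a, b)) (arc_obj (Some c, d))
  1%:M.
Proof.
move=> ac bd; split; first by rewrite !arc_obj_nil2 mulmx1 mul1mx.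
move=> i j; case: (ord2P i) => ->; case: (ord2P j) => -> hh; rewrite mxE //.
  by exfalso; move: hh => /=; lia.
by exfalso; move: hh => /=; lia.
Qed.

Lemma fhom_eps a b d : a <= d -> @is_fhom (arc_obj (Some a, b)) (arc_obj (None, d)) eps.
Proof.
move=> ad; split.
  rewrite arc_obj_nil2; have E : nil2 *m eps = eps *m 0.
    by rewrite mulmx0 /nil2 /eps mul_block_col !mul0mx !mulmx0 !addr0 col_mx0.
  exact: E.
move=> i j; rewrite (ord1 j); case: (ord2P i) => -> hh; first exact: epsE.1.
by exfalso; move: hh => /=; lia.
Qed.

Lemma fhom_kap b c d : b <= d -> @is_fhom (arc_obj (None, b)) (arc_obj (Some c, d)) kap.
Proof.
move=> bd; split.
  rewrite arc_obj_nil2; have E : 0 *m kap = kap *m nil2.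
    by rewrite mul0mx /nil2 /kap mul_row_block !mulmx0 !mul0mx !addr0 row_mx0.
  exact: E.
move=> i j; rewrite (ord1 i); case: (ord2P j) => -> hh; last exact: kapE.2.
by exfalso; move: hh => /=; lia.
Qed.

Lemma fhom_lim b d : b <= d -> @is_fhom (arc_obj (None, b)) (arc_obj (None, d)) 1%:M.
Proof.
move=> bd; split; last by move=> i j /= hh; exfalso; move: hh; lia.
have E : (0 : 'M[CC]_1) *m 1%:M = 1%:M *m 0 by rewrite mulmx1 mul1mx.
exact: E.
Qed.

Lemma fhom_finfin a b c d F : @is_fhom (arc_obj (Some a, b)) (arc_obj (Some c, d)) F ->
  exists x y : CC, F = x *: 1%:M + y *: nil2 /\
    (x = 0 \/ a <= c /\ b <= d) /\ (y = 0 \/ a <= d).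
Proof.
rewrite /is_fhom !arc_obj_nil2 => -[e l]; exists (F 1 1), (F 1 0).
have [m0 m1] := (fun i => (mul_nil2 F i).1, fun i => (mul_nil2 F i).2).
have [n0 n1] := (fun j => (nil2_mul F j).1, fun j => (nil2_mul F j).2).
have F01 : F 0 1 = 0.
  apply: etrans (esym (m0 0)) (etrans _ (n0 0)).
  exact: (congr1 (fun A : 'M_2 => A 0 0) (esym e)).
have F00 : F 0 0 = F 1 1.
  apply: etrans (esym (n1 0)) (etrans _ (m0 1)).
  exact: (congr1 (fun A : 'M_2 => A 1 0) e).
split; last split.
- have [a0 a1 a2 a3] := nil2E.
  have lin (x y : CC) (A B : 'M[CC]_(1 + 1)) i j : (x *: A + y *: B) i j = x * A i j + y * B i j.
    by rewrite !mxE.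
  by apply: eq_mx22; rewrite lin ?a0 ?a1 ?a2 ?a3 mxE /= ?mulr0 ?mulr1 ?addr0 ?add0r.
- case: (ltP c a) => hc; first by left; apply: l.
  case: (ltP d b) => hd; first by left; rewrite -F00; apply: l.
  by right.
- by case: (ltP d a) => hd; [left; apply: l | right].
Qed.

Lemma fhom_finlim a b d F : @is_fhom (arc_obj (Some a, b)) (arc_obj (None, d)) F ->
  exists y : CC, F = y *: eps /\ (y = 0 \/ a <= d).
Proof.
rewrite /is_fhom !arc_obj_nil2 => -[e l]; exists (F 1 0).
have F00 : F 0 0 = 0.
  rewrite -(nil2_mul F 0).2; apply: (etrans (congr1 (fun A : 'M_(2, 1) => A 1 0) e)).
  have E : (F : 'M_(2, 1)) *m (0 : 'M_1) = 0 by rewrite mulmx0.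
  by apply: (etrans (congr1 (fun A : 'M_(2, 1) => A 1 0) E)); rewrite mxE.
split; last by case: (ltP d a) => hd; [left; apply: l | right].
apply/matrixP => i j; rewrite (ord1 j) mxE.
by case: (ord2P i) => ->; rewrite ?epsE.1 ?epsE.2 ?mulr0 ?mulr1.
Qed.

Lemma fhom_limfin b c d F : @is_fhom (arc_obj (None, b)) (arc_obj (Some c, d)) F ->
  exists y : CC, F = y *: kap /\ (y = 0 \/ b <= d).
Proof.
rewrite /is_fhom !arc_obj_nil2 => -[e l]; exists (F 0 0).
have F01 : F 0 1 = 0.
  rewrite -(mul_nil2 F 0).1; apply: (etrans (congr1 (fun A : 'M_(1, 2) => A 0 0) (esym e))).
  have E : (0 : 'M_1) *m (F : 'M_(1, 2)) = 0 by rewrite mul0mx.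
  by apply: (etrans (congr1 (fun A : 'M_(1, 2) => A 0 0) E)); rewrite mxE.
split; last by case: (ltP d b) => hd; [left; apply: l | right].
apply/matrixP => i j; rewrite (ord1 i) mxE.
by case: (ord2P j) => ->; rewrite ?kapE.1 ?kapE.2 ?mulr0 ?mulr1.
Qed.

Lemma fhom_limlim b d F : @is_fhom (arc_obj (None, b)) (arc_obj (None, d)) F ->
  exists y : CC, F = y *: 1%:M /\ (y = 0 \/ b <= d).
Proof.
move=> [e l]; exists (F 0 0); split.
  by apply/matrixP => i j; rewrite (ord1 i) (ord1 j) !mxE mulr1.
by case: (ltP d b) => hd; [left; apply: l | right].
Qed.

(** * Approximations by arcs of a triangulation with a fountain *)

Definition right_approx (S : Defs.arc -> Prop) X : Prop :=
  exists t (F : 'M_(rk (fobj_of t), rk X)), leaves S t /\ @is_fhom (fobj_of t) X F /\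
    forall al G, S al -> @is_fhom (arc_obj al) X G ->
      exists H, @is_fhom (arc_obj al) (fobj_of t) H /\ G = H *m F.

Definition left_approx (S : Defs.arc -> Prop) X : Prop :=
  exists t (F : 'M_(rk X, rk (fobj_of t))), leaves S t /\ @is_fhom X (fobj_of t) F /\
    forall al G, S al -> @is_fhom X (arc_obj al) G ->
      exists H, @is_fhom (fobj_of t) (arc_obj al) H /\ G = F *m H.

(* For each of the finitely many right ends [d] in the window, the arc [(c, d)] of [S]
   with the largest [c <= e] absorbs all the others. *)
Lemma right_window S Y (G0 : 'M_(2, rk Y)) e dm :
  (forall c d, c <= e -> d <= dm -> @is_fhom (arc_obj (Some c, d)) Y G0) ->
  S (Some e, e + 1) -> forall k : nat, e + 1 + k%:Z <= dm ->
  exists t F, leaves S t /\ @is_fhom (fobj_of t) Y F /\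
    forall c d, S (Some c, d) -> c <= e -> d <= e + 1 + k%:Z ->
      exists H, @is_fhom (arc_obj (Some c, d)) (fobj_of t) H /\ G0 = H *m F.
Proof.
move=> hG Se; elim=> [|k IH] hk.
  (* The arc (e, e + 1) dominates every arc with c <= e and d <= e + 1. *)
  exists (ATarc (Some e, e + 1)), G0; split=> //; split; first by apply: hG; lia.
  move=> c d _ ce de; exists 1%:M; split; last by rewrite mul1mx.
  by apply: fhom_id; lia.
have [|t [F [St [hF cov]]]] := IH; first lia.
set d0 := e + 1 + k.+1%:Z in hk *.
case: (classic (exists c, c <= e /\ S (Some c, d0))) => [[c0 [c0e Sc0]]|no]; last first.
  exists t, F; split=> //; split=> // c d Scd ce de.
  have [e0|ne] := eqVneq d d0; first by exfalso; apply: no; exists c; rewrite -e0.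
  by apply: cov => //; move: ne; rewrite /d0 in de *; lia.
have [c1 [[c1e Sc1] max]] :
    exists c, (c <= e /\ S (Some c, d0)) /\ forall c', c' <= e /\ S (Some c', d0) -> c' <= c.
  by apply: (@int_max (fun c => c <= e /\ S (Some c, d0)) c0 e) => // n [].
exists (ATsum t (ATarc (Some c1, d0))), (col_mx F G0); split=> //; split.
  by apply/fhom_suml; split=> //; apply: hG => //; rewrite /d0 in hk *; lia.
move=> c d Scd ce de; have [e0|ne] := eqVneq d d0.
  exists (row_mx 0 1%:M); split; last by rewrite mul_row_col mul0mx add0r mul1mx.
  apply/fhom_sumr; split; first exact: fhom_zero.
  by apply: fhom_id; [apply: max; rewrite -e0 | rewrite e0].
have [|H [hH eH]] := cov c d Scd ce; first by move: ne; rewrite /d0 in de *; lia.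
exists (row_mx H 0); split; last by rewrite mul_row_col mul0mx addr0.
by apply/fhom_sumr; split=> //; apply: fhom_zero.
Qed.

(** Dual window: for each left end the arc with the smallest right end d >= f suffices. That minimum
    is obtained as a maximum of negatives. *)
Lemma left_window S Y (G0 : 'M_(rk Y, 2)) f cm :
  (forall c d, cm <= c -> f <= d -> @is_fhom Y (arc_obj (Some c, d)) G0) ->
  S (Some (f - 1), f) -> forall k : nat, cm <= f - 1 - k%:Z ->
  exists t F, leaves S t /\ @is_fhom Y (fobj_of t) F /\
    forall c d, S (Some c, d) -> f - 1 - k%:Z <= c -> f <= d ->
      exists H, @is_fhom (fobj_of t) (arc_obj (Some c, d)) H /\ G0 = F *m H.
Proof.
move=> hG Sf; elim=> [|k IH] hk.
  exists (ATarc (Some (f - 1), f)), G0; split=> //; split; first by apply: hG; lia.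
  move=> c d _ ce de; exists 1%:M; split; last by rewrite mulmx1.
  by apply: fhom_id; lia.
have [|t [F [St [hF cov]]]] := IH; first lia.
set c0 := f - 1 - k.+1%:Z in hk *.
case: (classic (exists d, f <= d /\ S (Some c0, d))) => [[d0 [d0e Sd0]]|no]; last first.
  exists t, F; split=> //; split=> // c d Scd ce de.
  have [e0|ne] := eqVneq c c0; first by exfalso; apply: no; exists d; rewrite -e0.
  by apply: cov => //; move: ne; rewrite /c0 in ce *; lia.
have [d1 [[d1e Sd1] min]] :
    exists d, (f <= d /\ S (Some c0, d)) /\ forall d', f <= d' /\ S (Some c0, d') -> d <= d'.
  have [m [[m1 m2] hm]] : exists m, (f <= - m /\ S (Some c0, - m)) /\
      forall n, f <= - n /\ S (Some c0, - n) -> n <= m.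
    apply: (@int_max (fun m => f <= - m /\ S (Some c0, - m)) (- d0) (- f)).
      by rewrite opprK.
    by move=> n [h _]; lia.
  exists (- m); split=> // d' hd'; have := hm (- d'); rewrite opprK => /(_ hd'); lia.
exists (ATsum t (ATarc (Some c0, d1))), (row_mx F G0); split=> //; split.
  by apply/fhom_sumr; split=> //; apply: hG => //; rewrite /c0 in hk *; lia.
move=> c d Scd ce de; have [e0|ne] := eqVneq c c0.
  exists (col_mx 0 1%:M); split; last by rewrite mul_row_col mulmx0 add0r mulmx1.
  apply/fhom_suml; split; first exact: fhom_zero.
  by apply: fhom_id; [rewrite e0 | apply: min; rewrite -e0].
have [|H [hH eH]] := cov c d Scd _ de; first by move: ne; rewrite /c0 in ce *; lia.
exists (col_mx H 0); split; last by rewrite mul_row_col mulmx0 addr0.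
by apply/fhom_suml; split=> //; apply: fhom_zero.
Qed.

(** The end-point inequalities from which approximations are built. [ff_ncl] says that no arc passes
    over a: it would cross a long arc of the right fountain. *)
Record fountain_facts (S : Defs.arc -> Prop) (a : int) : Prop := FountainFacts {
  ff_short : forall e, S (Some e, e + 1);
  ff_lim : S (None, a);
  ff_uniq : forall b, S (None, b) -> b = a;
  ff_valid : forall c d, S (Some c, d) -> c < d;
  ff_right : forall m, exists b, m < b /\ S (Some a, b);
  ff_left : forall m, exists b, b < m /\ S (Some b, a);
  ff_nc : forall c d c' d', S (Some c, d) -> S (Some c', d') -> c < c' -> c' < d -> d' <= d;
  ff_ncl : forall c d, S (Some c, d) -> c < a -> d <= a }.

Lemma right_approx_lim S a f : fountain_facts S a -> right_approx S (arc_obj (None, f)).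
Proof.
(* Beyond B an arc with c <= f must go through (-oo, a). For a <= f, let B be the right end of a
   long fountain arc (a, B): an arc with a < c and d > B would cross it. For f < a no arc passes
   over a, so B = a leaves nothing beyond. *)
move=> ff; have [B [fB hB]] : exists B, f + 1 <= B /\
    forall c d, S (Some c, d) -> c <= f -> B < d -> c <= a /\ a <= f.
  case: (leP a f) => af.
    have [b [bf Sb]] := ff_right ff (f + 1); exists b; split; first lia.
    move=> c d Scd cf bd; split=> //; rewrite leNgt; apply/negP => ac.
    by have := ff_nc ff Sb Scd ac; lia.
  by exists a; split; [lia|] => c d Scd cf ad; have := ff_ncl ff Scd; lia.
have [||t [F [St [hF cov]]]] := @right_window S (arc_obj (None, f)) eps f B _ (ff_short ff f)
  (absz (B - (f + 1))%R).
- by move=> c d cf _; apply: fhom_eps.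
- by lia.
have eB : f + 1 + (absz (B - (f + 1))%R)%:Z = B by lia.
rewrite {}eB in cov.
have [t' [F' [St' [hF' [cov1 cov2]]]]] : exists t F, leaves S t /\
      @is_fhom (fobj_of t) (arc_obj (None, f)) F /\
    (forall c d, S (Some c, d) -> c <= f -> exists H, @is_fhom (arc_obj (Some c, d)) (fobj_of t)
      H /\ eps = H *m F) /\
    (a <= f -> exists H, @is_fhom (arc_obj (None, a)) (fobj_of t) H /\ 1%:M = H *m F).
  case: (leP a f) => af; last first.
    exists t, F; split=> //; split=> //; split; last by lia.
    move=> c d Scd cf; apply: cov => //.
    by rewrite leNgt; apply/negP => /(hB c d Scd cf); lia.
  exists (ATsum t (ATarc (None, a))), (col_mx F 1%:M); split; first by split=> //; apply: ff_lim.
  split; first by apply/fhom_suml; split=> //; apply: fhom_lim.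
  split=> [c d Scd cf|_].
    case: (leP d B) => dB.
      have [H [hH eH]] := cov c d Scd cf dB.
      exists (row_mx H 0); split; last by rewrite mul_row_col mul0mx addr0.
      by apply/fhom_sumr; split=> //; apply: fhom_zero.
    exists (row_mx 0 eps); split; last by rewrite mul_row_col mul0mx add0r mulmx1.
    apply/fhom_sumr; split; first exact: fhom_zero.
    by apply: fhom_eps; have := hB c d Scd cf dB; lia.
  exists (row_mx 0 1%:M); split; last by rewrite mul_row_col mul0mx add0r mulmx1.
  by apply/fhom_sumr; split; [apply: fhom_zero | apply: fhom_lim].
exists t', F'; split=> //; split=> // -[[c|] d] G Sal hG.
  have [y [-> [->|cf]]] := fhom_finlim hG.
    by exists 0; split; [apply: fhom_zero | rewrite mul0mx scale0r].
  have [H [hH ->]] := cov1 c d Sal cf.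
  by exists (y *: H); split; [apply: fhom_scale | rewrite scalemxAl].
have [y [-> [->|df]]] := fhom_limlim hG.
  by exists 0; split; [apply: fhom_zero | rewrite mul0mx scale0r].
rewrite (ff_uniq ff Sal) in df *.
have [H [hH ->]] := cov2 df.
by exists (y *: H); split; [apply: fhom_scale | rewrite scalemxAl].
Qed.

(** A map from a finite arc is x 1 + y N. The identity part occurs only for c <= e and d <= f, a
    finite window. The N part, like any map from a limit arc, factors through [kap] from (-oo, f),
    whose approximation is known. *)
Lemma right_approx_fin S a e f : fountain_facts S a -> e < f ->
  right_approx S (arc_obj (Some e, f)).
Proof.
move=> ff ef; have [t2 [F2 [St2 [hF2 cov2]]]] := right_approx_lim f ff.
have [||t1 [F1 [St1 [hF1 cov1]]]] := @right_window S (arc_obj (Some e, f)) 1%:M e f _ (ff_short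
  ff e)
  (absz (f - (e + 1))%R).
- by move=> c d; apply: fhom_id.
- by lia.
have eB : e + 1 + (absz (f - (e + 1))%R)%:Z = f by lia.
rewrite {}eB in cov1.
have hk : @is_fhom (arc_obj (None, f)) (arc_obj (Some e, f)) kap by apply: fhom_kap.
exists (ATsum t1 t2), (col_mx F1 (F2 *m kap)); split=> //; split.
  by apply/fhom_suml; split=> //; apply: fhom_comp hF2 hk.
move=> [[c|] d] G Sal hG.
  have [x [y [-> [hx hy]]]] := fhom_finfin hG.
  have [H1 [hH1 eH1]] : exists H, @is_fhom (arc_obj (Some c, d)) (fobj_of t1) H /\ x *: 1%:M = H
    *m F1.
    case: hx => [->|[ce df]].
      by exists 0; split; [apply: fhom_zero | rewrite mul0mx scale0r].
    have [H [hH ->]] := cov1 c d Sal ce df.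
    by exists (x *: H); split; [apply: fhom_scale | rewrite scalemxAl].
  have [H2 [hH2 eH2]] : exists H, @is_fhom (arc_obj (Some c, d)) (fobj_of t2) H /\ y *: nil2 = H
    *m (F2 *m kap).
    case: hy => [->|cf].
      by exists 0; split; [apply: fhom_zero | rewrite mul0mx scale0r].
    have [H [hH eH]] := cov2 (Some c, d) (y *: eps) Sal (fhom_scale y (fhom_eps d cf)).
    exists H; split=> //; rewrite mulmxA.
    by rewrite -eps_kap scalemxAl; congr (_ *m kap).
  exists (row_mx H1 H2); split; first by apply/fhom_sumr.
  by rewrite mul_row_col -eH1 -eH2.
have [y [-> [->|df]]] := fhom_limfin hG.
  by exists 0; split; [apply: fhom_zero | rewrite mul0mx scale0r].
have [H [hH eH]] := cov2 (None, d) (y *: 1%:M) Sal (fhom_scale y (fhom_lim df)).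
exists (row_mx 0 H); split; first by apply/fhom_sumr; split=> //; apply: fhom_zero.
rewrite mul_row_col mul0mx add0r mulmxA.
have -> : y *: kap = (y *: 1%:M) *m kap by rewrite -scalemxAl mul1mx.
by congr (_ *m kap).
Qed.

Lemma left_approx_lim S a f : fountain_facts S a -> left_approx S (arc_obj (None, f)).
Proof.
(* Dually, for f <= a let B be the left end of a long fountain arc (B, a): an arc with c < B and d
   >= f must satisfy a <= d in order not to cross it, and then receives [kap] from (-oo, a). *)
move=> ff; have [B [fB hB]] : exists B, B <= f - 1 /\
    forall c d, S (Some c, d) -> f <= d -> c < B -> f <= a /\ a <= d.
  case: (leP f a) => af.
    have [c0 [cf Sc]] := ff_left ff (f - 1); exists c0; split; first lia.
    move=> c d Scd fd cc0; split=> //.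
    by have := ff_nc ff Scd Sc cc0; lia.
  by exists a; split; [lia|] => c d Scd fd ca; have := ff_ncl ff Scd ca; lia.
have eS : f - 1 + 1 = f by lia.
have Sf : S (Some (f - 1), f) by have := ff_short ff (f - 1); rewrite eS.
have [||t [F [St [hF cov]]]] := @left_window S (arc_obj (None, f)) kap f B _ Sf
  (absz (f - 1 - B)%R).
- by move=> c d _; apply: fhom_kap.
- by lia.
have eB : f - 1 - (absz (f - 1 - B)%R)%:Z = B by lia.
rewrite {}eB in cov.
have [t' [F' [St' [hF' [cov1 cov2]]]]] : exists t F, leaves S t /\
      @is_fhom (arc_obj (None, f)) (fobj_of t) F /\
    (forall c d, S (Some c, d) -> f <= d -> exists H, @is_fhom (fobj_of t) (arc_obj (Some c, d))
      H /\ kap = F *m H) /\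
    (f <= a -> exists H, @is_fhom (fobj_of t) (arc_obj (None, a)) H /\ 1%:M = F *m H).
  case: (leP f a) => af; last first.
    exists t, F; split=> //; split=> //; split; last by lia.
    move=> c d Scd fd; apply: cov => //.
    by rewrite leNgt; apply/negP => /(hB c d Scd fd); lia.
  exists (ATsum t (ATarc (None, a))), (row_mx F 1%:M); split; first by split=> //; apply: ff_lim.
  split; first by apply/fhom_sumr; split=> //; apply: fhom_lim.
  split=> [c d Scd fd|_].
    case: (leP B c) => cB.
      have [H [hH eH]] := cov c d Scd cB fd.
      exists (col_mx H 0); split; last by rewrite mul_row_col mulmx0 addr0.
      by apply/fhom_suml; split=> //; apply: fhom_zero.
    exists (col_mx 0 kap); split; last by rewrite mul_row_col mulmx0 add0r mul1mx.
    apply/fhom_suml; split; first exact: fhom_zero.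
    by apply: fhom_kap; have := hB c d Scd fd cB; lia.
  exists (col_mx 0 1%:M); split; last by rewrite mul_row_col mulmx0 add0r mul1mx.
  by apply/fhom_suml; split; [apply: fhom_zero | apply: fhom_lim].
exists t', F'; split=> //; split=> // -[[c|] d] G Sal hG.
  have [y [-> [->|fd]]] := fhom_limfin hG.
    by exists 0; split; [apply: fhom_zero | rewrite mulmx0 scale0r].
  have [H [hH ->]] := cov1 c d Sal fd.
  by exists (y *: H); split; [apply: fhom_scale | rewrite scalemxAr].
have [y [-> [->|df]]] := fhom_limlim hG.
  by exists 0; split; [apply: fhom_zero | rewrite mulmx0 scale0r].
rewrite (ff_uniq ff Sal) in df *.
have [H [hH ->]] := cov2 df.
by exists (y *: H); split; [apply: fhom_scale | rewrite scalemxAr].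
Qed.

(** As for right approximations, except that the N part now factors through [eps] into (-oo, e). *)
Lemma left_approx_fin S a e f : fountain_facts S a -> e < f ->
  left_approx S (arc_obj (Some e, f)).
Proof.
move=> ff ef; have [t2 [F2 [St2 [hF2 cov2]]]] := left_approx_lim e ff.
have eS : f - 1 + 1 = f by lia.
have Sf : S (Some (f - 1), f) by have := ff_short ff (f - 1); rewrite eS.
have [||t1 [F1 [St1 [hF1 cov1]]]] := @left_window S (arc_obj (Some e, f)) 1%:M f e _ Sf
  (absz (f - 1 - e)%R).
- by move=> c d; apply: fhom_id.
- by lia.
have eB : f - 1 - (absz (f - 1 - e)%R)%:Z = e by lia.
rewrite {}eB in cov1.
have hk : @is_fhom (arc_obj (Some e, f)) (arc_obj (None, e)) eps by apply: fhom_eps.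
exists (ATsum t1 t2), (row_mx F1 (eps *m F2)); split=> //; split.
  by apply/fhom_sumr; split=> //; apply: fhom_comp hk hF2.
move=> [[c|] d] G Sal hG.
  have [x [y [-> [hx hy]]]] := fhom_finfin hG.
  have [H1 [hH1 eH1]] : exists H, @is_fhom (fobj_of t1) (arc_obj (Some c, d)) H /\ x *: 1%:M =
    F1 *m H.
    case: hx => [->|[ce df]].
      by exists 0; split; [apply: fhom_zero | rewrite mulmx0 scale0r].
    have [H [hH ->]] := cov1 c d Sal ce df.
    by exists (x *: H); split; [apply: fhom_scale | rewrite scalemxAr].
  have [H2 [hH2 eH2]] : exists H, @is_fhom (fobj_of t2) (arc_obj (Some c, d)) H /\ y *: nil2 =
    eps *m F2 *m H.
    case: hy => [->|ed].
      by exists 0; split; [apply: fhom_zero | rewrite mulmx0 scale0r].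
    have [H [hH eH]] := cov2 (Some c, d) (y *: kap) Sal (fhom_scale y (fhom_kap c ed)).
    exists H; split=> //; rewrite -mulmxA.
    by rewrite -eps_kap scalemxAr; congr (eps *m _).
  exists (col_mx H1 H2); split; first by apply/fhom_suml.
  by rewrite mul_row_col -eH1 -eH2.
have [y [-> [->|ed]]] := fhom_finlim hG.
  by exists 0; split; [apply: fhom_zero | rewrite mulmx0 scale0r].
have [H [hH eH]] := cov2 (None, d) (y *: 1%:M) Sal (fhom_scale y (fhom_lim ed)).
exists (col_mx 0 H); split; first by apply/fhom_suml; split=> //; apply: fhom_zero.
rewrite mul_row_col mulmx0 add0r -mulmxA.
have -> : y *: eps = eps *m (y *: 1%:M) by rewrite -scalemxAr mulmx1.
by congr (eps *m _).
Qed.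

Lemma right_approx_tree S a t : fountain_facts S a -> leaves valid_arc t ->
  right_approx S (fobj_of t).
Proof.
move=> ff; elim: t => [_|[[e|] f]|t1 IH1 t2 IH2 [v1 v2]].
- exists ATzero, 0; split=> //; split; first exact: fhom_zero.
  move=> al G _ _; exists 0; split; first exact: fhom_zero.
  by apply/matrixP => ? -[].
- by move=> v; apply: right_approx_fin ff _.
- by move=> _; apply: right_approx_lim ff.
have [u1 [F1 [S1 [h1 c1]]]] := IH1 v1; have [u2 [F2 [S2 [h2 c2]]]] := IH2 v2.
exists (ATsum u1 u2), (block_mx F1 0 0 F2); split=> //; split.
  by apply/fhom_suml; split; apply/fhom_sumr; split=> //; apply: fhom_zero.
move=> al G Sal; rewrite -[G]hsubmxK => /fhom_sumr[hG1 hG2].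
have [H1 [k1 e1]] := c1 al _ Sal hG1; have [H2 [k2 e2]] := c2 al _ Sal hG2.
exists (row_mx H1 H2); split; first by apply/fhom_sumr.
by rewrite mul_row_block !mulmx0 addr0 add0r -e1 -e2.
Qed.

Lemma left_approx_tree S a t : fountain_facts S a -> leaves valid_arc t ->
  left_approx S (fobj_of t).
Proof.
move=> ff; elim: t => [_|[[e|] f]|t1 IH1 t2 IH2 [v1 v2]].
- exists ATzero, 0; split=> //; split; first exact: fhom_zero.
  move=> al G _ _; exists 0; split; first exact: fhom_zero.
  by apply/matrixP => -[].
- by move=> v; apply: left_approx_fin ff _.
- by move=> _; apply: left_approx_lim ff.
have [u1 [F1 [S1 [h1 c1]]]] := IH1 v1; have [u2 [F2 [S2 [h2 c2]]]] := IH2 v2.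
exists (ATsum u1 u2), (block_mx F1 0 0 F2); split=> //; split.
  by apply/fhom_suml; split; apply/fhom_sumr; split=> //; apply: fhom_zero.
move=> al G Sal; rewrite -[G]vsubmxK => /fhom_suml[hG1 hG2].
have [H1 [k1 e1]] := c1 al _ Sal hG1; have [H2 [k2 e2]] := c2 al _ Sal hG2.
exists (col_mx H1 H2); split; first by apply/fhom_suml.
by rewrite mul_block_col !mul0mx addr0 add0r -e1 -e2.
Qed.

Lemma right_factor S t X (F : 'M_(rk (fobj_of t), rk X)) :
  (forall al G, S al -> @is_fhom (arc_obj al) X G ->
     exists H, @is_fhom (arc_obj al) (fobj_of t) H /\ G = H *m F) ->
  forall u G, leaves S u -> @is_fhom (fobj_of u) X G -> exists H, @is_fhom (fobj_of u) (fobj_of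
    t) H /\ G = H *m F.
Proof.
move=> cov; elim=> [|al|u1 IH1 u2 IH2] G.
- by move=> _ _; exists 0; split; [apply: fhom_zero | apply/matrixP => -[]].
- exact: cov.
move=> [s1 s2]; rewrite -[G]vsubmxK => /fhom_suml[hG1 hG2].
have [H1 [k1 e1]] := IH1 _ s1 hG1; have [H2 [k2 e2]] := IH2 _ s2 hG2.
exists (col_mx H1 H2); split; first by apply/fhom_suml.
by rewrite mul_col_mx -e1 -e2.
Qed.

Lemma left_factor S t X (F : 'M_(rk X, rk (fobj_of t))) :
  (forall al G, S al -> @is_fhom X (arc_obj al) G ->
     exists H, @is_fhom (fobj_of t) (arc_obj al) H /\ G = F *m H) ->
  forall u G, leaves S u -> @is_fhom X (fobj_of u) G -> exists H, @is_fhom (fobj_of t) (fobj_of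
    u) H /\ G = F *m H.
Proof.
move=> cov; elim=> [|al|u1 IH1 u2 IH2] G.
- by move=> _ _; exists 0; split; [apply: fhom_zero | apply/matrixP => ? -[]].
- exact: cov.
move=> [s1 s2]; rewrite -[G]hsubmxK => /fhom_sumr[hG1 hG2].
have [H1 [k1 e1]] := IH1 _ s1 hG1; have [H2 [k2 e2]] := IH2 _ s2 hG2.
exists (row_mx H1 H2); split; first by apply/fhom_sumr.
by rewrite mul_mx_row -e1 -e2.
Qed.

(** * Cluster tilting subcategories *)

Lemma leaves_all (I : Type) (S : I -> Prop) (Q : I -> Defs.arc -> Prop) t :
  leaves (fun al => forall i, S i -> Q i al) t <-> forall i, S i -> leaves (Q i) t.
Proof.
elim: t => [|al|t1 IH1 t2 IH2] //=; rewrite IH1 IH2; split=> [[h1 h2] i Si|h].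
  by split; [apply: h1 | apply: h2].
by split=> i Si; case: (h i Si).
Qed.

Lemma leaves_and Q Q' t : leaves Q t -> leaves Q' t -> leaves (fun al => Q al /\ Q' al) t.
Proof. by elim: t => //= t1 IH1 t2 IH2 [a1 a2] [b1 b2]; split; auto. Qed.

Lemma subcat_tree P t : is_subcat P -> leaves valid_arc t ->
  P (grmod_of t) <-> leaves (arcs_of P) t.
Proof.
move=> [_ [P0 [PD [_ PS]]]]; elim: t => [|al|t1 IH1 t2 IH2] //=.
  by move=> v; split=> [|[]].
move=> [v1 v2]; rewrite -IH1 // -IH2 //; split; first exact: PS.
by case; apply: PD.
Qed.

(** Closure under isomorphisms, sums and summands lets any one decomposition decide membership. *)
Lemma subcat_realizes P M t : is_subcat P -> leaves valid_arc t -> realizes M (fobj_of t) ->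
  P M <-> leaves (arcs_of P) t.
Proof.
move=> sP vt rM; have rt := realizes_tree vt; rewrite -(subcat_tree sP vt).
have [_ [_ [_ [PI _]]]] := sP.
split=> h; apply: (PI _ _ h).
- exact: (realizes_in_C2 (square_zero_tree t) rt).
- exact: (realizes_giso rM rt).
- exact: (realizes_in_C2 (square_zero_tree t) rM).
- exact: (realizes_giso rt rM).
Qed.

Lemma subcat_decompose P M : is_subcat P -> P M ->
  exists t, [/\ leaves valid_arc t, leaves (arcs_of P) t & realizes M (fobj_of t)].
Proof.
move=> sP PM; have [t [vt rt]] := decompose (sP.1 M PM).
by exists t; split=> //; apply/(subcat_realizes sP vt rt).
Qed.

(** Cocycles and coboundaries split along direct sums in both arguments, so vanishing is a condition
    on pairs of leaves. *)
Lemma right_perp P M t : is_subcat P -> leaves valid_arc t -> realizes M (fobj_of t) ->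
  (forall T, P T -> Ext1_zero T M) <->
  leaves (fun be => forall al, arcs_of P al -> ~ ext_arcs al be) t.
Proof.
move=> sP vt rM; rewrite leaves_all; split=> [h al [va Pa]|h T PT].
  have := Ext1_zero_trivial (square_zero_tree (ATarc al)) (square_zero_tree t) (realizes_arc va)
    rM (h _ Pa).
  by move/(ext_trivial_tree (ATarc al) t) => /=; apply: leaves_sub => be /ext_trivial_arcs.
have [u [vu Su ru]] := subcat_decompose sP PT.
apply: (trivial_Ext1_zero (square_zero_tree u) (square_zero_tree t) ru rM);
  apply/ext_trivial_tree.
apply: leaves_sub Su => al /h; apply: leaves_sub => be; exact: (ext_trivial_arcs al be).2.
Qed.

Lemma left_perp P M t : is_subcat P -> leaves valid_arc t -> realizes M (fobj_of t) ->
  (forall T, P T -> Ext1_zero M T) <->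
  leaves (fun be => forall al, arcs_of P al -> ~ ext_arcs be al) t.
Proof.
move=> sP vt rM; split=> [h|h T PT].
  apply/leaves_all => al [va Pa].
  have := Ext1_zero_trivial (square_zero_tree t) (square_zero_tree (ATarc al)) rM (realizes_arc
    va) (h _ Pa).
  by move/(ext_trivial_tree t (ATarc al)) => /=; apply: leaves_sub => be /ext_trivial_arcs.
have [u [vu Su ru]] := subcat_decompose sP PT.
apply: (trivial_Ext1_zero (square_zero_tree t) (square_zero_tree u) rM ru);
  apply/ext_trivial_tree.
apply: leaves_sub h => be hbe; apply: leaves_sub Su => al /hbe.
exact: (ext_trivial_arcs be al).2.
Qed.

Lemma crossing_sym al be : crossing al be -> crossing be al.
Proof. by case: al be => a b [c d] /=; tauto. Qed.

Lemma emb_inj M X r (phi : forall n, 'M[CC]_(gdim M n, rk X)) (F G : 'M_(rk X, r)) :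
  based phi (lv X) -> (forall n, phi n *m F = phi n *m G) -> F = G.
Proof.
move=> b h; have [n0 full] := based_exhausting b.
exact: row_full_cancel (full n0 (lexx _)) (h n0).
Qed.

Lemma ghom_fhom M M' X Y phi phi' (f : ghom M M') :
  @emb M _ (nilp X) phi -> based phi (lv X) -> @emb M' _ (nilp Y) phi' -> based phi' (lv Y) ->
  is_ghom f -> exists F, @is_fhom X Y F /\ forall n, f n *m phi' n = phi n *m F.
Proof.
move=> e b e' b' hf; have [F [c [l h]]] := ghom_mx e (based_exhausting b) e' hf.
by exists F; split=> //; split=> //; apply/(filtered_based _ b e' b').
Qed.

Lemma fhom_ghom M M' X Y phi phi' F :
  @emb M _ (nilp X) phi -> based phi (lv X) -> @emb M' _ (nilp Y) phi' -> based phi' (lv Y) ->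
  @is_fhom X Y F -> exists f : ghom M M', is_ghom f /\ forall n, f n *m phi' n = phi n *m F.
Proof.
move=> e b e' b' [c l].
have fF : filtered phi phi' F by apply/(filtered_based _ b e' b').
exists (mx_ghom phi phi' F); split; first exact: mx_ghomP e e' fF c.
exact: mx_ghomE.
Qed.

Lemma contravariantly_finite_fountain P a : is_subcat P ->
  fountain_facts (arcs_of P) a -> contravariantly_finite P.
Proof.
move=> sP ff M cM; have [t [vt [p [e b]]]] := decompose cM.
have [u [F [Su [hF cov]]]] := right_approx_tree ff vt.
have vu : leaves valid_arc u by apply: leaves_sub Su => al [].
have [pu [eu bu]] := realizes_tree vu.
have [f [hf fF]] := fhom_ghom eu bu e b hF.
exists (grmod_of u), f; split; first by apply/(subcat_tree sP vu).
split=> // T g PT hg; have [w [vw Sw [pw [ew bw]]]] := subcat_decompose sP PT.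
have [G [hG gG]] := ghom_fhom ew bw e b hg.
have [H [hH eH]] := right_factor cov Sw hG.
have [h [hh hH']] := fhom_ghom ew bw eu bu hH.
have [fr _ _] := e.
exists h; split=> // n; apply: (row_free_inj (fr n)).
by rewrite gG eH -[RHS]mulmxA fF !mulmxA hH'.
Qed.

Lemma covariantly_finite_fountain P a : is_subcat P ->
  fountain_facts (arcs_of P) a -> covariantly_finite P.
Proof.
move=> sP ff M cM; have [t [vt [p [e b]]]] := decompose cM.
have [u [F [Su [hF cov]]]] := left_approx_tree ff vt.
have vu : leaves valid_arc u by apply: leaves_sub Su => al [].
have [pu [eu bu]] := realizes_tree vu.
have [f [hf fF]] := fhom_ghom e b eu bu hF.
exists (grmod_of u), f; split; first by apply/(subcat_tree sP vu).
split=> // T g PT hg; have [w [vw Sw [pw [ew bw]]]] := subcat_decompose sP PT.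
have [G [hG gG]] := ghom_fhom e b ew bw hg.
have [H [hH eH]] := left_factor cov Sw hG.
have [h [hh hH']] := fhom_ghom eu bu ew bw hH.
have [fr _ _] := ew.
exists h; split=> // n; apply: (row_free_inj (fr n)).
by rewrite gG eH -[RHS]mulmxA hH' !mulmxA fF.
Qed.

(** * Fountains and limit arcs in a triangulation *)

Lemma triangulation_fountain_facts S a :
  triangulation S -> has_fountain S a -> fountain_facts S a.
Proof.
move=> [val [nc max]] [[br [brS br_in]] [bl [blS bl_in]]].
have short e : S (Some e, e + 1).
  apply: max => [|[[c|] d] _ /=]; rewrite /valid_arc /=; first lia.
    by lia.
  by lia.
have right m : exists b, m < b /\ S (Some a, b).
  have hb (i : nat) : br 0%N + i%:Z <= br i.
    by elim: i => [|i IH]; [lia | have := brS i; lia].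
  exists (br (absz (m + 1 - br 0%N)%R)); split=> //.
  by have := hb (absz (m + 1 - br 0%N)%R); lia.
have left m : exists b, b < m /\ S (Some b, a).
  have hb (i : nat) : bl i <= bl 0%N - i%:Z.
    by elim: i => [|i IH]; [lia | have := blS i; lia].
  exists (bl (absz (m - 1 - bl 0%N)%R)); split=> //.
  by have := hb (absz (m - 1 - bl 0%N)%R); lia.
have ncl c d : S (Some c, d) -> c < a -> d <= a.
  move=> Scd ca; rewrite leNgt; apply/negP => ad.
  have [b [db Sb]] := right d; have := nc _ _ Scd Sb; apply=> /=; left; lia.
split=> //.
- apply: max => // -[[c|] d] Scd /=; last by lia.
  by case=> [[_ [ca ad]]|[]] //; have := ncl c d Scd ca; lia.
(* A limit arc ending elsewhere is crossed by a fountain arc reaching beyond b, on the left if b < a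
   and on the right if b > a. *)
- move=> b Sb; case: (ltgtP b a) => // ba.
    have [c [cb Sc]] := left b; have := nc _ _ Sb Sc; case=> /=; left; lia.
  have [c [cb Sc]] := right b; have := nc _ _ Sb Sc; case=> /=; left; lia.
- by move=> c d /val; rewrite /valid_arc.
- move=> c d c' d' S1 S2 cc cd; rewrite leNgt; apply/negP => dd.
  by have := nc _ _ S1 S2; apply=> /=; left.
Qed.

Lemma increasing_seq (Q : int -> Prop) : (forall m, exists b, m < b /\ Q b) ->
  exists b : nat -> int, (forall i, b i < b i.+1) /\ forall i, Q (b i).
Proof.
move=> h; have [f hf] : exists f : int -> int, forall m, m < f m /\ Q (f m).
  exists (fun m => proj1_sig (constructive_indefinite_description _ (h m))) => m.
  exact: (proj2_sig (constructive_indefinite_description _ (h m))).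
(* The iteration starts at 1, since the seed 0 need not satisfy [Q]. *)
exists (fun i => iter i.+1 f 0); split=> i; first by rewrite [iter i.+2 _ _]iterS; case: (hf
  (iter i.+1 f 0)).
by rewrite iterS; case: (hf (iter i f 0)).
Qed.

(** Were the right ends at a bounded, with largest b, an arc (c, d) over b would cross (-oo, a) if c
    < a, cross (a, b) if c > a, and contradict the choice of b if c = a. So (-oo, b) would belong to
    S, against uniqueness. The left ends are treated symmetrically, through their negatives. *)
Lemma limit_arc_fountain S a : triangulation S -> S (None, a) ->
  (forall b, S (None, b) -> b = a) -> has_fountain S a.
Proof.
move=> [val [nc max]] Sa uniq.
have short e : S (Some e, e + 1).
  apply: max => [|[[c|] d] _ /=]; rewrite /valid_arc /=; first lia.
    by lia.
  by lia.
split.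
  apply: (@increasing_seq (fun x => S (Some a, x))) => m; apply: NNPP => no.
  have [b [Sb hb]] : exists b, S (Some a, b) /\ forall n, S (Some a, n) -> n <= b.
    apply: (@int_max (fun n => S (Some a, n)) (a + 1) m) => // n Sn.
    by rewrite leNgt; apply/negP => mn; apply: no; exists n.
  have ab := hb _ (short a).
  have : S (None, b).
    apply: max => // -[[c|] d] Scd /=; last by lia.
    case=> [[_ [cb bd]]|[]] //.
    case: (ltgtP c a) => ca.
    - by have := nc _ _ Sa Scd; apply=> /=; left; lia.
    - by have := nc _ _ Sb Scd; apply=> /=; left; lia.
    - by rewrite ca in Scd; have := hb _ Scd; lia.
  by move/uniq; lia.
have [b [b1 b2]] : exists b : nat -> int, (forall i, b i < b i.+1) /\
    forall i, S (Some (- b i), a).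
  apply: (@increasing_seq (fun x => S (Some (- x), a))) => m; apply: NNPP => no.
  have [c [Sc hc]] : exists c, S (Some (- c), a) /\ forall n, S (Some (- n), a) -> n <= c.
    apply: (@int_max (fun n => S (Some (- n), a)) (1 - a) m) => [|n Sn].
      by have -> : - (1 - a) = a - 1 by [lia]; have := short (a - 1); rewrite subrK.
    by rewrite leNgt; apply/negP => mn; apply: no; exists n.
  have ca : - c < a by have := val _ Sc.
  have : S (None, - c).
    apply: max => // -[[e|] f] Sef /=; last by lia.
    case=> [[_ [ec cf]]|[]] //.
    case: (ltgtP f a) => fa.
    - by have := nc _ _ Sef Sc; apply=> /=; left; lia.
    - by have := nc _ _ Sa Sef; apply=> /=; left; lia.
    - by rewrite fa in Sef; have := hc (- e); rewrite opprK => /(_ Sef); lia.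
  by move/uniq; lia.
by exists (fun i => - b i); split=> // i; have := b1 i; lia.
Qed.

(** * Contravariant finiteness forces a limit arc *)

(** A sum of finite arcs is free over C[N]/(N^2), each arc contributing the generator v. *)
Lemma ker_sub_im t : leaves (fun al => al.1 <> None) t ->
  forall u : 'rV_(rk (fobj_of t)), u *m nilp (fobj_of t) = 0 -> exists z, u = z *m nilp (fobj_of
    t).
Proof.
elim: t => [_ u _|[[a|] b] //= _ u|t1 IH1 t2 IH2 [v1 v2] u].
- by exists 0; apply/rowP => -[].
- rewrite -[X in _ *m X]/(nilp (arc_obj (Some a, b))) arc_obj_nil2 => h.
  exists (const_mx (u 0 0)); rewrite -[X in _ *m X]/(nilp (arc_obj (Some a, b))) arc_obj_nil2.
  apply/rowP => j; case: (ord2P j) => ->.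
    by apply: etrans (esym (mul_nil2 _ 0).1); rewrite mxE.
  apply: etrans (esym (mul_nil2 _ 0).2); rewrite -(mul_nil2 u 0).1.
  by apply: etrans (congr1 (fun A : 'M_(1, 2) => A 0 0) h) _; rewrite mxE.
- rewrite -[u](@hsubmxK _ _ (rk (fobj_of t1)) (rk (fobj_of t2))).
  move: (lsubmx _) (rsubmx _) => u1 u2.
  have E k (w1 : 'M_(k, _)) w2 : row_mx w1 w2 *m nilp (fsum (fobj_of t1) (fobj_of t2))
      = row_mx (w1 *m nilp (fobj_of t1)) (w2 *m nilp (fobj_of t2)).
    have E : row_mx w1 w2 *m block_mx (nilp (fobj_of t1)) 0 0 (nilp (fobj_of t2))
        = row_mx (w1 *m nilp (fobj_of t1)) (w2 *m nilp (fobj_of t2)).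
      by rewrite mul_row_block !mulmx0 addr0 add0r.
    exact: E.
  move=> h; have := etrans (esym (E _ u1 u2)) h; rewrite -[0]row_mx0 => /eq_row_mx[h1 h2].
  have [z1 ->] := IH1 v1 u1 h1; have [z2 ->] := IH2 v2 u2 h2.
  by exists (row_mx z1 z2); rewrite -E.
Qed.

(* If all arcs of [t] ended before [d], [H] would kill [v N], hence send [v] into
   [ker N = im N], which [F] kills. *)
Lemma factor_bound t y (F : 'M_(rk (fobj_of t), 1)) : leaves (fun al => al.1 <> None) t ->
  @is_fhom (fobj_of t) (arc_obj (None, y)) F ->
  exists D : int, forall c d H, @is_fhom (arc_obj (Some c, d)) (fobj_of t) H -> H *m F = eps ->
    d <= D.
Proof.
move=> nl [cF _]; have [D hD] := fin_bound (lv (fobj_of t)); exists D => c d H [cH lH] HF.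
rewrite leNgt; apply/negP => Dd.
have H0 : row (0 : 'I_2) H = 0.
  by apply/rowP => j; rewrite !mxE lH //=; have := hD j; lia.
have e : row (1 : 'I_2) H *m nilp (fobj_of t) = 0.
  rewrite -row_mul -cH arc_obj_nil2 -H0; apply/rowP => j; rewrite mxE [RHS]mxE.
  exact: (nil2_mul H j).2.
have [z ez] := ker_sub_im nl e.
have : row (1 : 'I_2) H *m F = 0.
  rewrite ez -mulmxA cF mulmxA; have E (w : 'M[CC]_1) : w *m (0 : 'M_1) = 0 by rewrite mulmx0.
  exact: E.
rewrite -row_mul HF => /rowP/(_ 0); rewrite mxE epsE.2 [RHS]mxE => /eqP.
by rewrite oner_eq0.
Qed.

Lemma contravariantly_finite_limit P : is_subcat P -> contravariantly_finite P ->
  triangulation (arcs_of P) -> exists a, arcs_of P (None, a).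
Proof.
move=> sP cf [val [nc max]]; apply: NNPP => no.
have v0 : valid_arc (None, 0) by [].
have r0 := realizes_arc v0.
have [T0 [f [PT0 [hf cov]]]] := cf _ (realizes_in_C2 (square_zero_tree (ATarc (None, 0))) r0).
have [t [vt St [pt [et bt]]]] := subcat_decompose sP PT0.
have [p0 [e0 b0]] := r0.
have [F [hF fF]] := ghom_fhom et bt e0 b0 hf.
have nl : leaves (fun al => al.1 <> None) t.
  by apply: leaves_sub St => -[[a|] b] //= Sb; exfalso; apply: no; exists b.
have [D hD] := factor_bound nl hF.
have bound c d : arcs_of P (Some c, d) -> c <= 0 -> d <= D.
  move=> [va Pcd] c0; have [p [e b]] := realizes_arc va.
  have [g [hg gG]] := fhom_ghom e b e0 b0 (fhom_eps d c0).
  have [h [hh gh]] := cov _ g Pcd hg.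
  have [H [hH hHE]] := ghom_fhom e b et bt hh.
  apply: (hD c d H hH); apply: esym; apply: (emb_inj b) => n.
  by rewrite -gG gh -mulmxA fF !mulmxA hHE.
(* The arc (-oo, b) is absent, so by maximality it is crossed, and only a finite arc passing over b
   can do so. *)
have out b : exists c d, arcs_of P (Some c, d) /\ c < b /\ b < d.
  apply: NNPP => h; apply: no; exists b; apply: max => // -[[c|] d] Scd /=; last by lia.
  by case=> [[_ [cb bd]]|[]] //; apply: h; exists c, d.
have [c0 [d0 [S0 [c00 d00]]]] := out 0.
(* Let d1 be the largest right end of an arc with c <= 0, attained by (c1, d1). An arc (c2, d2) over
   d1 does not cross it, so c2 <= c1 <= 0 although d2 > d1. *)
have [d1 [[c1 [c10 S1]] hd]] : exists d, (exists c, c <= 0 /\ arcs_of P (Some c, d)) /\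
    forall d', (exists c, c <= 0 /\ arcs_of P (Some c, d')) -> d' <= d.
  apply: (@int_max (fun d => exists c, c <= 0 /\ arcs_of P (Some c, d)) d0 D).
    by exists c0; split=> //; apply: ltW.
  by move=> d [c [cc Sc]]; apply: bound Sc cc.
have d10 : d0 <= d1 by apply: hd; exists c0; split=> //; apply: ltW.
have [c2 [d2 [S2 [c2d d2d]]]] := out d1.
have c21 : c2 <= c1.
  by rewrite leNgt; apply/negP => h; have := nc _ _ S1 S2; apply=> /=; left; lia.
have := hd d2; suff h : exists c, c <= 0 /\ arcs_of P (Some c, d2) by move/(_ h); lia.
by exists c2; split=> //; apply: le_trans c21 c10.
Qed.

(** * The equivalence *)

Lemma cluster_tilting_perp P : is_subcat P -> cluster_tilting P -> forall be, valid_arc be ->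
  (arcs_of P be <-> forall al, arcs_of P al -> ~ ext_arcs al be) /\
  (arcs_of P be <-> forall al, arcs_of P al -> ~ ext_arcs be al).
Proof.
move=> sP [_ [h1 h2]] be vb; have rb := realizes_arc vb.
have cb : in_C2 (arc_mod be) := realizes_in_C2 (square_zero_tree (ATarc be)) rb.
have e : arcs_of P be <-> P (arc_mod be) by split=> [[]|].
split; rewrite e.
  exact: (iff_trans (h1 _ cb) (right_perp (t := ATarc be) sP vb rb)).
exact: (iff_trans (h2 _ cb) (left_perp (t := ATarc be) sP vb rb)).
Qed.

Lemma cluster_tilting_triangulation P : is_subcat P -> cluster_tilting P ->
  triangulation (arcs_of P) /\
  (forall b c, arcs_of P (None, b) -> arcs_of P (None, c) -> b = c).
Proof.
move=> sP ct; have perp := cluster_tilting_perp sP ct; set S := arcs_of P in perp *.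
have val al : S al -> valid_arc al by case.
have next al be : S al -> S be -> ~ ext_arcs al be.
  by move=> Sa Sb; apply: ((perp be (val _ Sb)).1.1 Sb).
have uniq b c : S (None, b) -> S (None, c) -> b = c.
  move=> Sb Sc; case: (ltgtP b c) => // h; exfalso.
    by apply: (next _ _ Sb Sc); right.
  by apply: (next _ _ Sc Sb); right.
split=> //; split=> //; split=> [al be Sa Sb cr|al va nc].
  by apply: (next _ _ Sa Sb); left.
have [r l] := perp al va.
(* If S has no limit arc, [ext_arcs] with members of S is just crossing, and one perpendicular
   condition suffices. *)
case: (classic (exists c, S (None, c))) => [[c Sc]|no]; last first.
  apply/r => be Sb [/crossing_sym|]; first exact: nc.
  by case: be Sb => [[?|] d] Sd [] // _ _; apply: no; exists d.
case: al va nc r l => [[a|] b] va nc r l.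
  by apply: r.2 => be Sb [/crossing_sym|[_ []] //]; apply: nc.
(* For a limit arc (-oo, b) the one-sided extension with (-oo, c) must be avoided: for b < c there
   is none from (-oo, c) to (-oo, b), and for b > c none the other way, which selects the condition
   to use. *)
case: (ltgtP b c) => bc; last by rewrite bc.
- apply: r.2 => be Sb [/crossing_sym|]; first exact: nc.
  case: be Sb => [[?|] d] Sd [] // _ [_ /= db].
  by have := uniq _ _ Sd Sc; lia.
- apply: l.2 => be Sb [|]; first exact: nc.
  case: be Sb => [[?|] d] Sd [_ [e /= db]] //.
  by have := uniq _ _ Sd Sc; lia.
Qed.

Lemma fountain_cluster_tilting P a : is_subcat P -> triangulation (arcs_of P) ->
  has_fountain (arcs_of P) a -> cluster_tilting P.
Proof.
move=> sP tr ft; have ff := triangulation_fountain_facts tr ft.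
have [val [nc max]] := tr.
(* The fountain leaves a single limit arc, and a limit arc does not extend itself, so rigidity
   reduces to non-crossing. *)
have next al be : arcs_of P al -> arcs_of P be -> ~ ext_arcs al be.
  case: al be => [[a1|] b1] [[a2|] b2] S1 S2; case; try exact: nc; move=> -[] // _ [] // _ /=.
  by rewrite (ff_uniq ff S1) (ff_uniq ff S2) ltxx.
split; first by split; [apply: contravariantly_finite_fountain ff | apply:
  covariantly_finite_fountain ff].
split=> M cM; have [t [vt rt]] := decompose cM; rewrite (subcat_realizes sP vt rt).
  rewrite (right_perp sP vt rt); split.
    by apply: leaves_sub => be Sb al Sa; apply: next.
  move/(leaves_and vt); apply: leaves_sub => be [vb h]; apply: max => // al Sa cr.
  by apply: (h al Sa); left; apply: crossing_sym.
rewrite (left_perp sP vt rt); split.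
  by apply: leaves_sub => be Sb al Sa; apply: next.
move/(leaves_and vt); apply: leaves_sub => be [vb h]; apply: max => // al Sa cr.
by apply: (h al Sa); left.
Qed.

Theorem theorem4p11 (P : grmod -> Prop) :
  is_subcat P ->
  (cluster_tilting P <->
   (triangulation (arcs_of P) /\ exists a : int, has_fountain (arcs_of P) a)).
Proof.
move=> sP; split=> [ct|[tr [a ft]]]; last exact: fountain_cluster_tilting ft.
have [tr uniq] := cluster_tilting_triangulation sP ct; split=> //.
have [a Sa] := contravariantly_finite_limit sP ct.1.1 tr.
by exists a; apply: limit_arc_fountain => // b Sb; apply: uniq.
Qed.
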